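(* Let $k^*$ be the maximal type of $f$, i.e. the largest type among the (finitely many) global maximum points of $f$, and let $\mu_1,\dots,\mu_P$ be the global maximum points of $f$ whose type equals $k^*$, with strengths $\lambda_1,\dots,\lambda_P$. Then, as $N\to\infty$, the law of $m_N(\sigma)$ under $P_N$ converges weakly to the probability measure $$\frac{\sum_{p=1}^P b_p\,\delta_{\mu_p}}{\sum_{p=1}^P b_p},\qquad b_p=(-\lambda_p)^{-1/(2k^* )},$$ where $\delta_{\mu_p}$ is the unit point mass at $\mu_p$.
   Context: Let $\rho$ be a non-degenerate Borel probability measure on $\mathbb{R}$ such that $\int_{\mathbb{R}}\exp\big(\tfrac{a x^2}{2}+bx\big)\,d\rho(x)<\infty$ for all $a>0$, $b\in\mathbb{R}$. Fix $J>0$ and $h\in\mathbb{R}$. For $N\ge1$ and $\sigma=(\sigma_1,\dots,\sigma_N)\in\mathbb{R}^N$ let $H_N(\sigma)=-\frac{J}{2N}\sum_{i,j=1}^N\sigma_i\sigma_j-h\sum_{i=1}^N\sigma_i$, and let $P_N$ be the probability measure on $\mathbb{R}^N$ given by $dP_N(\sigma)=Z_N^{-1}\exp(-H_N(\sigma))\prod_{i=1}^N d\rho(\sigma_i)$, where $Z_N$ is the normalizing constant. Let $S_N(\sigma)=\sum_{i=1}^N\sigma_i$ and $m_N(\sigma)=S_N(\sigma)/N$. Define $f(x)=-\frac{J}{2}x^2+\ln\int_{\mathbb{R}}\exp\big(s(Jx+h)\big)\,d\rho(s)$; $f$ is real analytic, tends to $-\infty$ at $\pm\infty$ and has finitely many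 global maximum points. For a global maximum point $\mu$ of $f$, its type is the positive integer $k$ and its strength is the negative real $\lambda$ such that $f^{(j)}(\mu)=0$ for $1\le j\le 2k-1$ and $f^{(2k)}(\mu)=\lambda<0$, i.e. $f(x)=f(\mu)+\lambda\frac{(x-\mu)^{2k}}{(2k)!}+o((x-\mu)^{2k})$ as $x\to\mu$. *)

(* Defs.v *)
From HB Require Import structures.
From mathcomp Require Import all_boot all_order all_algebra.
From mathcomp Require Import all_classical all_reals all_analysis.
Set Implicit Arguments. Unset Strict Implicit. Unset Printing Implicit Defensive.
Import Order.TTheory GRing.Theory Num.Theory.
Import numFieldNormedType.Exports.
Local Open Scope classical_set_scope.
Local Open Scope ring_scope.

Section CurieWeiss.
Variable R : realType.

(* Iterated integral with respect to the N-fold product rho^{(x)N} on R^N,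
   points of R^N being represented as N-tuples. *)
Fixpoint prod_int (rho : {measure set R -> \bar R}) (n : nat) :
    (n.-tuple R -> \bar R) -> \bar R :=
  match n return (n.-tuple R -> \bar R) -> \bar R with
  | 0 => fun F => F [tuple]
  | n'.+1 => fun F =>
      (\int[rho]_x prod_int rho (fun t : n'.-tuple R => F [tuple of x :: t]))%E
  end.

Definition S_N (n : nat) (s : n.-tuple R) : R := \sum_(x <- s) x.
Definition m_N (n : nat) (s : n.-tuple R) : R := S_N s / n%:R.

Definition H_N (J h : R) (n : nat) (s : n.-tuple R) : R :=
  - (J / (2 * n%:R)) * (S_N s) ^+ 2 - h * S_N s.

Definition Z_N (rho : {measure set R -> \bar R}) (J h : R) (n : nat) : \bar R :=
  prod_int rho (fun s : n.-tuple R => (expR (- H_N J h s))%:E).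

Definition gibbs_expect (rho : {measure set R -> \bar R}) (J h : R)
    (g : R -> R) (n : nat) : R :=
  fine (prod_int rho (fun s : n.-tuple R => (g (m_N s) * expR (- H_N J h s))%:E))
  / fine (Z_N rho J h n).

Definition fCW (rho : {measure set R -> \bar R}) (J h : R) (x : R) : R :=
  - (J / 2) * x ^+ 2 + ln (fine (\int[rho]_s (expR (s * (J * x + h)))%:E)%E).

End CurieWeiss.

(* Main.v *)
(* By the Hubbard-Stratonovich transform, if [m_N] follows the Gibbs measure and [G] is an
   independent centred Gaussian of variance [1 / (N J)], then [m_N + G] has density
   proportional to [expR (N f x)], where [f = fCW].  Since [G] tends to [0], the limit of
   [E (g m_N)] is that of [\int g expR (N f) / \int expR (N f)], which is computed by
   Laplace's method: a global maximum of type [k] and strength [lam] contributes a mass of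
   order [(- lam N / (2k)!)^(- 1 / (2k))], so the maxima of largest type dominate.  Taylor's
   expansion of [f] at its maxima is legitimate because [f] is smooth, by differentiation
   under the integral sign. *)
Require Import Defs.
From HB Require Import structures.
From mathcomp Require Import all_boot all_order all_algebra.
From mathcomp Require Import all_classical all_reals all_analysis.
From mathcomp Require Import measurable_realfun ring lra.
Import Order.TTheory GRing.Theory Num.Theory.
Import numFieldNormedType.Exports.
Local Open Scope classical_set_scope.
Local Open Scope ring_scope.

(** * Smooth functions and Taylor's formula *)

(** The test function is only bounded and continuous, so [g m_N] and [g (m_N + G)] cannot be
    compared uniformly. They are compared where the smoothed variable lies near one of the finitely
    many maxima, so that continuity at those points suffices; the complementary event is charged to
    the density [expR (N f)], for which the Laplace asymptotics themselves show it negligible. Large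
    values of [G] cost a Gaussian tail, exponentially small in [N]. All this is one explicit
    inequality at fixed [N], [gibbs_smoothing]. The maxima have different natural scales
    [N ^ (1 / (2k))]. Every integral is multiplied by the single power [N ^ (1 / (2 kstar))]; this
    power, the integral of [expR (- y ^+ kstar.*2)] and the power of the factorial are common to all
    maxima of largest type and cancel in the quotient. *)

Section Smoothness.
Context {R : realType}.
Implicit Types (f g : R -> R) (n m : nat).

(** Existence of [n] successive derivatives everywhere, without continuity of the last one;
    [Cn n.+1] provides that continuity. Recursing on the derivative makes the closure lemmas direct
    inductions. *)
Fixpoint Cn n f : Prop :=
  if n is n'.+1 then (forall x, derivable f x 1) /\ Cn n' f^`()%classic else True.

Lemma CnW n f : Cn n.+1 f -> Cn n f.
Proof.
elim: n f => // n IH f [df Cf]; split => //; exact: IH.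
Qed.

Lemma Cn_derive n f (df : R -> R) :
  (forall x : R, is_derive x 1 f (df x)) -> Cn n df -> Cn n.+1 f.
Proof.
move=> fdf Cdf; split; first by move=> x; have [] := fdf x.
suff -> : f^`()%classic = df by [].
by apply/funext => x; rewrite derive1E; have [_ ->] := fdf x.
Qed.

Lemma Cn_is_derive n f (x : R) : Cn n.+1 f -> is_derive x 1 f (f^`()%classic x).
Proof. by case=> df _; rewrite derive1E; apply: DeriveDef. Qed.

Lemma Cn_cst n (c : R) : Cn n (cst c).
Proof.
elim: n c => // n IH c; exact: (Cn_derive _ _ (cst 0)).
Qed.

Lemma CnD n f g : Cn n f -> Cn n g -> Cn n (fun x => f x + g x).
Proof.
elim: n f g => // n IH f g Cf Cg.
apply: (Cn_derive _ _ (fun x => (f^`()%classic x) + g^`()%classic x)).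
  move=> x; have fx := Cn_is_derive n f x Cf.
  have gx := Cn_is_derive n g x Cg.
  exact: (@is_deriveD _ _ _ f g x 1).
by case: Cf Cg => _ Cf [_ Cg]; exact: IH.
Qed.

Lemma CnM n f g : Cn n f -> Cn n g -> Cn n (fun x => f x * g x).
Proof.
elim: n f g => // n IH f g Cf Cg.
apply: (Cn_derive _ _ (fun x => f x * g^`()%classic x + g x * (f^`()%classic x))).
  move=> x; have fx := Cn_is_derive n f x Cf.
  have gx := Cn_is_derive n g x Cg.
  exact: (@is_deriveM _ _ f g x 1).
have [_ Cf'] := Cf; have [_ Cg'] := Cg.
by apply: CnD; apply: IH => //; exact: CnW.
Qed.

Lemma Cn_id n : Cn n (@id R).
Proof.
case: n => // n; apply: (Cn_derive _ _ (cst 1)); exact: Cn_cst.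
Qed.

(** The derivative is written with the inverse of [f] itself, so that the induction hypothesis
    applies to it. *)
Lemma CnV n f : (forall x, f x != 0) -> Cn n f -> Cn n (fun x => (f x)^-1).
Proof.
move=> f0; elim: n => // n IH Cf.
apply: (Cn_derive _ _ (fun x => - 1 * ((f x)^-1 * (f x)^-1) * (f^`()%classic x))).
  move=> x; have fx := Cn_is_derive n f x Cf.
  rewrite (_ : - 1 * _ * _ = - (f x) ^- 2 *: (f^`()%classic x)); last first.
    by rewrite /GRing.scale/= expr2 invfM; ring.
  exact: is_deriveV.
have [_ Cf'] := Cf; have {}IH := IH (CnW _ _ Cf).
by do 2![apply: CnM => //]; [exact: Cn_cst|exact: CnM].
Qed.

Lemma Cn_ln n f : (forall x, 0 < f x) -> Cn n f -> Cn n (fun x => ln (f x)).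
Proof.
move=> f0; case: n => // n Cf.
have f_neq0 x : f x != 0 by rewrite gt_eqF.
apply: (Cn_derive _ _ (fun x => (f x)^-1 * (f^`()%classic x))).
  move=> x; have fx := Cn_is_derive n f x Cf.
  by have := is_derive1_ln (f0 x) => lx; exact: is_derive1_comp.
apply: CnM; last by case: Cf.
by apply: CnV => //; exact: CnW.
Qed.

Lemma Cn_continuous n f : Cn n.+1 f -> continuous f.
Proof.
by case=> df _ x; exact/differentiable_continuous/derivable1_diffP/df.
Qed.

(** Induction on [m] through the derivative: the remainder [G] vanishes at 0 and [G'] is the
    remainder of the derivative, bounded by [e * |t| ^+ m], so the mean value theorem yields one
    more factor [|t|]. The extra order in [Cn m.+1] gives continuity of the [m]-th derivative in the
    base case. *)
Lemma taylor_peano m f (a l : R) : Cn m.+1 f ->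
  (forall j, (j < m)%N -> derive1n j f a = 0) -> derive1n m f a = l ->
  forall e : R, 0 < e -> exists2 d : R, 0 < d & forall t : R, `|t| < d ->
    `|f (a + t) - l * t ^+ m / m`!%:R| <= e * `|t| ^+ m.
Proof.
elim: m f => [|m IH] f Cf f0 fl e e0.
  have /cvgrPdist_le /(_ _ e0) := Cn_continuous _ _ Cf a.
  rewrite near_simpl => -[d /= d0 H]; exists d => // t td.
  rewrite expr0 !mulr1 divr1 -fl derive1n0 distrC.
  by apply: H => /=; rewrite opprD addNKr normrN.
have [d d0 H] := IH f^`()%classic (proj2 Cf)
  (fun j jm => ltac:(by rewrite -(f0 j.+1)// /derive1n iterSr))
  ltac:(by rewrite -fl /derive1n iterSr) e e0.
exists d => // t td.
pose G x := f (a + x) - l * x ^+ m.+1 / m.+1`!%:R.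
pose G' x := f^`()%classic (a + x) - l * x ^+ m / m`!%:R.
have dG (x : R) : is_derive x 1 G (G' x).
  have fx := Cn_is_derive _ _ (a + x) Cf.
  rewrite /G /G'; apply: is_deriveB.
    rewrite -[f^`()%classic _]mul1r.
    have h : is_derive x (1:R) (fun y : R => a + y) 1.
      by rewrite -[X in is_derive _ _ _ X]add0r; apply: is_deriveD.
    rewrite mulrC; exact: (@is_derive1_comp _ f (fun y : R => a + y)).
  under eq_fun do rewrite mulrAC.
  rewrite (_ : l * x ^+ m / _ = (l / m.+1`!%:R) *: (m.+1%:R * x ^+ m)); last first.
    rewrite /GRing.scale/= factS natrM; field.
    by rewrite pnatr_eq0 -lt0n fact_gt0 -(natrD _ 1) pnatr_eq0.
  apply: (@is_deriveZ _ _ _ (fun x : R => x ^+ m.+1)).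
  have := @is_deriveX _ _ (@id R) m.+1 x 1 1 (is_derive_id _ _).
  by rewrite exprfctE /GRing.scale/= mulr1.
have G0 : G 0 = 0 by rewrite /G addr0 expr0n/= mulr0 mul0r subr0 -(f0 0%N).
have cG (A : set R) : {within A, continuous G}.
  apply: continuous_subspaceT => x.
  by apply/differentiable_continuous/derivable1_diffP; have [] := dG x.
have bnd c : `|c| <= `|t| -> `|G' c| <= e * `|t| ^+ m.
  move=> ct; apply: le_trans (H c (le_lt_trans ct td)) _.
  by rewrite ler_pM2l// lerXn2r ?nnegrE.
suff [c ct Gt] : exists2 c, `|c| <= `|t| & G t = G' c * t.
  rewrite -/(G t) Gt normrM exprSr mulrA ler_wpM2r//; exact: bnd.
have [t0|t0] := leP 0 t.
  have [c] := @MVT_segment _ G G' 0 t t0 (fun x _ => dG x) (cG _).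
  rewrite in_itv/= G0 !subr0 => /andP[c0 ct] Gt; exists c => //.
  by rewrite !ger0_norm.
have [c] := @MVT_segment _ G G' t 0 (ltW t0) (fun x _ => dG x) (cG _).
rewrite in_itv/= G0 !sub0r => /andP[c0 ct] Gt; exists c => //.
  by rewrite !ler0_norm ?lerN2// ltW.
by move: Gt; rewrite mulrN => /oppr_inj.
Qed.

End Smoothness.

(** * Exponential moments *)

Section RintegralPositive.
Context d (T : measurableType d) (R : realType) (mu : {measure set T -> \bar R}).

(** If the integral were zero, [f] would vanish almost everywhere, and the whole space would be
    negligible. *)
Lemma Rintegral_gt0 (f : T -> R) : mu setT != 0%E -> (forall x, 0 < f x) ->
  mu.-integrable setT (EFin \o f) -> 0 < \int[mu]_x f x.
Proof.
move=> muT f0 intf; rewrite lt_neqAle; apply/andP; split; last first.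
  by apply: Rintegral_ge0 => x _; exact: ltW.
apply/eqP => i0.
have : (\int[mu]_(x in setT) `|(f x)%:E| = 0)%E.
  under eq_integral do rewrite gee0_abs ?lee_fin ?(ltW (f0 _))//.
  by rewrite -[LHS]fineK ?(integrable_fin_num _ intf)// -/(Rintegral _ _ _) -i0.
move/(ae_eq_integral_abs mu measurableT); case; first by case/integrableP : intf.
move=> A [mA A0 TA]; case/eqP : muT.
apply/eqP; rewrite eq_le measure_ge0 andbT -A0 le_measure ?inE//.
by move=> x _; apply: TA => /= /(_ I)/eqP; rewrite eqe gt_eqF.
Qed.

End RintegralPositive.

Section Domination.
Context {R : realType}.

Lemma expR_norm_le (c s : R) : 0 <= c ->
  expR (c * `|s|) <= expR (c * s) + expR (- c * s).
Proof.
move=> c0; have [s0|s0] := leP 0 s.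
  by rewrite ger0_norm// lerDl expR_ge0.
by rewrite ltr0_norm// mulrN mulNr lerDr expR_ge0.
Qed.

Lemma exprn_le_fact_expR (m : nat) (x : R) : 0 <= x -> x ^+ m <= m`!%:R * expR x.
Proof.
move=> x0; case: m => [|m].
  by rewrite expr0 mul1r -expR0 ler_expR.
rewrite -ler_pdivrMl ?ltr0n ?fact_gt0// mulrC.
by apply: le_trans (expR_ge1Dxn m x0); rewrite lerDr.
Qed.

End Domination.

Section LaplaceTransform.
Context {R : realType} (rho : probability R R).
Hypothesis exp_int : forall c : R, rho.-integrable setT (EFin \o (fun s => expR (c * s))).

(** The [j]-th derivative of the moment generating function of [rho], by
    [is_derive_tilted_moment]. *)
Definition tilted_moment (j : nat) (t : R) : R :=
  \int[rho]_s (s ^+ j * expR (s * t)).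

(** Dominates the integrand of [tilted_moment] for all [t] with [|t| + 1 <= c]: the spare unit of
    rate pays for [|s| ^+ j <= j! * expR |s|], and the sum of two exponentials replaces
    [expR (c * |s|)]. *)
Let G (j : nat) (c s : R) : R := j`!%:R * (expR (c * s) + expR (- c * s)).

Let G_ub j (c t s : R) : `|t| + 1 <= c -> `|s ^+ j * expR (s * t)| <= G j c s.
Proof.
move=> tc; have c0 : 0 <= c by apply: le_trans tc; rewrite addr_ge0.
rewrite normrM normrX (ger0_norm (expR_ge0 _)).
apply: (@le_trans _ _ ((j`!%:R * expR `|s|) * expR (`|s| * `|t|))).
  apply: ler_pM => //; [exact: exprn_le_fact_expR|].
  by rewrite ler_expR (le_trans (ler_norm _))// normrM.
rewrite -mulrA -expRD /G ler_wpM2l// (le_trans _ (expR_norm_le c s c0))// ler_expR.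
by rewrite -[X in X + _]mulr1 -mulrDr mulrC ler_wpM2r// addrC.
Qed.

Let G_int j c : rho.-integrable setT (EFin \o G j c).
Proof.
rewrite (_ : EFin \o _ = (fun s : R => j`!%:R%:E *
  ((EFin \o (fun s => expR (c * s))) s + (EFin \o (fun s => expR (- c * s))) s))%E).
  by apply: integrableZl => //; apply: integrableD.
by apply/funext => s.
Qed.

Lemma measurable_expR_mulr (t : R) :
  measurable_fun setT (fun s : R => expR (s * t)).
Proof. by apply: measurableT_comp => //; exact: measurable_funM. Qed.

Let measurable_moment j (t : R) :
  measurable_fun setT (fun s : R => s ^+ j * expR (s * t)).
Proof.
apply: measurable_funM; last exact: measurable_expR_mulr.
exact: measurable_funX.
Qed.

Lemma tilted_moment_integrable j (t : R) :
  rho.-integrable setT (EFin \o (fun s => s ^+ j * expR (s * t))).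
Proof.
apply: (le_integrable _ _ _ (G_int j (`|t| + 1))) => //.
  by apply/measurable_EFinP; exact: measurable_moment.
move=> s _; rewrite lee_fin (ger0_norm (x := G _ _ _)); first exact: G_ub.
by apply: le_trans (G_ub j _ t s (lexx _)).
Qed.

Let is_derive_kernel j (s t : R) :
  is_derive t 1 (fun t => s ^+ j * expR (s * t)) (s ^+ j.+1 * expR (s * t)).
Proof.
rewrite (_ : s ^+ j.+1 * _ = s ^+ j *: (expR (s * t) * s)); last first.
  by rewrite /GRing.scale/= exprS; ring.
apply: (@is_deriveZ _ _ _ (fun t : R => expR (s * t))).
have st : is_derive t (1:R) (fun t : R => s * t) s.
  rewrite -[X in is_derive _ _ _ X]mulr1.
  exact: (@is_deriveZ _ _ _ (@id R) s t 1 1).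
exact: (@is_derive1_comp _ expR (fun t : R => s * t)).
Qed.

Lemma is_derive_tilted_moment j (t : R) :
  is_derive t 1 (tilted_moment j) (tilted_moment j.+1 t).
Proof.
pose f (t s : R) : R := s ^+ j * expR (s * t).
have tI : `]t - 1, t + 1[%classic t by rewrite /= in_itv/= ltrBlDr ltrDl ltr01.
have df (x y : R) : partial1of2 f x y = y ^+ j.+1 * expR (y * x).
  by rewrite partial1of2E; have [_ ->] := is_derive_kernel j y x.
have intf x : `]t - 1, t + 1[%classic x -> rho.-integrable setT (EFin \o f x).
  by move=> _; exact: tilted_moment_integrable.
have derf x y : `]t - 1, t + 1[%classic x -> [set: R] y -> derivable (f ^~ y) x 1.
  by move=> _ _; have [] := is_derive_kernel j y x.
(* One unit is the radius of the interval around [t], the other is the one that [G_ub] spends on the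
   power of [s]. *)
have G0 s : 0 <= G j.+1 (`|t| + 1 + 1) s.
  by apply: le_trans (G_ub j.+1 (`|t| + 1 + 1) t s _); rewrite ?lerDl.
have G_bd x y : `]t - 1, t + 1[%classic x -> [set: R] y ->
    `|partial1of2 f x y| <= G j.+1 (`|t| + 1 + 1) y.
  rewrite /= in_itv/= => /andP[x1 x2] _; rewrite df; apply: G_ub.
  rewrite lerD2r -lerBlDl (le_trans (lerB_dist _ _))//.
  by rewrite ler_norml; apply/andP; split; lra.
apply: DeriveDef.
  exact: (@derivable_under_integral _ _ _ rho f _ measurableT t _ _ tI intf derf
    _ G0 (G_int _ _) G_bd).
rewrite -derive1E (@differentiation_under_integral _ _ _ rho f _ measurableT t
  _ _ tI intf derf _ G0 (G_int _ _) G_bd).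
by apply: eq_Rintegral => s _; rewrite df.
Qed.

Lemma tilted_moment0_gt0 (t : R) : 0 < tilted_moment 0 t.
Proof.
apply: Rintegral_gt0; last exact: tilted_moment_integrable.
  by apply/eqP => r0; have /eqP := probability_setT rho; rewrite r0 eqe eq_sym oner_eq0.
by move=> s; rewrite expr0 mul1r expR_gt0.
Qed.

End LaplaceTransform.

(** * The law of the sum of the spins *)

Section LawOfSum.
Context {R : realType}.
Implicit Types m : probability R R.

Definition add_pair (p : R * R) : R := p.1 + p.2.

Lemma measurable_add_pair : measurable_fun setT add_pair.
Proof. exact: measurable_funD. Qed.

HB.instance Definition _ :=
  isMeasurableFun.Build _ _ _ _ add_pair measurable_add_pair.

Definition convolution m1 m2 : probability R R :=
  distribution (m1 \x m2)%E add_pair.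

Section Convolution.
Variables m1 m2 : probability R R.

Lemma ge0_integral_convolution (f : R -> \bar R) : measurable_fun setT f ->
  (forall x, 0 <= f x)%E ->
  (\int[convolution m1 m2]_z f z = \int[m1]_x \int[m2]_y f (x + y)%R)%E.
Proof.
move=> mf f0; rewrite ge0_integral_distribution// fubini_tonelli1//=.
by apply: measurableT_comp mf _; exact: measurable_add_pair.
Qed.

Lemma integral_convolution (f : R -> R) : measurable_fun setT f ->
  (convolution m1 m2).-integrable setT (EFin \o f) ->
  (\int[convolution m1 m2]_z (f z)%:E = \int[m1]_x \int[m2]_y (f (x + y)%R)%:E)%E.
Proof.
move=> mf /integrableP[mEf intf].
have mf2 : measurable_fun setT (EFin \o f \o add_pair).
  by apply: measurableT_comp mEf _; exact: measurable_add_pair.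
have intf2 : (m1 \x m2)%E.-integrable setT (EFin \o f \o add_pair).
  apply/integrableP; split => //; move: intf.
  by rewrite ge0_integral_distribution//; exact: measurableT_comp.
rewrite (@integral_pushforward _ _ _ _ _ _ measurable_add_pair _ setT)//.
by rewrite preimage_setT -integral12_prod_meas1.
Qed.

End Convolution.

(* The law of [S_N]: everything under the Gibbs measure depends on the spins through
   their sum only, so [prod_int] is never needed on general functions of tuples. *)
Fixpoint sum_law (rho : probability R R) (n : nat) : probability R R :=
  if n is n'.+1 then convolution rho (sum_law rho n') else dirac (0 : R).

Variable rho : probability R R.

Lemma sum_lawS n : sum_law rho n.+1 = convolution rho (sum_law rho n).
Proof. by []. Qed.

Lemma prod_intS n (F : n.+1.-tuple R -> \bar R) :
  prod_int rho F =
  (\int[rho]_x prod_int rho (fun t : n.-tuple R => F [tuple of x :: t]))%E.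
Proof. by []. Qed.

Hypothesis sqexp_int : forall a : R, 0 < a ->
  (\int[rho]_x (expR (a * x ^+ 2))%:E < +oo)%E.

Lemma measurable_expR_sqr (a : R) :
  measurable_fun [set: R] (fun x : R => expR (a * x ^+ 2)).
Proof.
by apply: measurableT_comp => //; apply: measurable_funM => //; exact: measurable_funX.
Qed.

Lemma scaled_sqrD_le2 (a x y : R) : 0 <= a ->
  a * (x + y) ^+ 2 <= 2 * a * x ^+ 2 + 2 * a * y ^+ 2.
Proof.
move=> a0; rewrite -subr_ge0 (_ : _ - _ = a * (x - y) ^+ 2); last by ring.
by rewrite mulr_ge0// sqr_ge0.
Qed.

(** Since [(x + y)^2 <= 2 x^2 + 2 y^2], each added spin doubles the rate; hence the induction for
    all [a], and the use of [sqexp_int] at arbitrarily large rates. *)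
Lemma sum_law_sqexp n (a : R) : 0 < a ->
  (\int[sum_law rho n]_x (expR (a * x ^+ 2))%:E < +oo)%E.
Proof.
elim: n a => [|n IH] a a0.
  rewrite /= integral_dirac//; last by apply/measurable_EFinP; exact: measurable_expR_sqr.
  by rewrite diracT mul1e ltry.
rewrite sum_lawS ge0_integral_convolution//; last first.
  by apply/measurable_EFinP; exact: measurable_expR_sqr.
pose c := fine (\int[sum_law rho n]_x (expR (2 * a * x ^+ 2))%:E)%E.
have a20 : 0 < 2 * a by rewrite mulr_gt0.
have cE : (\int[sum_law rho n]_x (expR (2 * a * x ^+ 2))%:E = c%:E)%E.
  rewrite /c fineK// ge0_fin_numE ?IH//.
  by apply: integral_ge0 => x _; rewrite lee_fin expR_ge0.
have c0 : 0 <= c by apply: fine_ge0; apply: integral_ge0 => x _; rewrite lee_fin expR_ge0.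
apply: (@le_lt_trans _ _ (\int[rho]_x ((expR (2 * a * x ^+ 2))%:E * c%:E))%E).
  apply: ge0_le_integral => //.
  - by move=> x _; apply: integral_ge0 => y _; rewrite lee_fin expR_ge0.
  - apply: (measurable_fun_fubini_tonelli_F (m2 := sum_law rho n)
      (fun p : R * R => (expR (a * (p.1 + p.2) ^+ 2))%:E)) => //.
    apply/measurable_EFinP.
    exact: (measurableT_comp (measurable_expR_sqr a) measurable_add_pair).
  - by apply: emeasurable_funM => //; apply/measurable_EFinP; exact: measurable_expR_sqr.
  move=> x _; rewrite -cE -ge0_integralZl//; last first.
    by apply/measurable_EFinP; exact: measurable_expR_sqr.
  apply: ge0_le_integral => //.
  - apply/measurable_EFinP.
    apply: (measurableT_comp (measurable_expR_sqr a)); exact: measurable_funD.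
  - by apply: emeasurable_funM => //; apply/measurable_EFinP; exact: measurable_expR_sqr.
  by move=> y _; rewrite -EFinM -expRD lee_fin ler_expR scaled_sqrD_le2// ltW.
rewrite ge0_integralZr//; last first.
  by apply/measurable_EFinP; exact: measurable_expR_sqr.
rewrite muleC lte_mul_pinfty// ?lee_fin//; exact: sqexp_int.
Qed.

Lemma integrable_sum_law n (f : R -> R) (a C : R) : 0 < a ->
  measurable_fun setT f -> (forall x, `|f x| <= C * expR (a * x ^+ 2)) ->
  (sum_law rho n).-integrable setT (EFin \o f).
Proof.
move=> a0 mf fle.
apply: (@le_integrable _ _ _ _ _ measurableT _
  (EFin \o (fun x => C * expR (a * x ^+ 2)))).
- by apply/measurable_EFinP.
- by move=> x _; rewrite lee_fin (le_trans (fle x))// ler_norm.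
apply: (@eq_integrable _ _ _ _ _ measurableT
  (fun x : R => C%:E * (EFin \o (fun x : R => expR (a * x ^+ 2))) x)%E) => //.
apply: integrableZl => //; apply/integrableP; split.
  by apply/measurable_EFinP; exact: measurable_expR_sqr.
under eq_integral do rewrite gee0_abs ?lee_fin ?expR_ge0//.
exact: sum_law_sqexp.
Qed.

(** Growth at most [C * expR (a * x ^+ 2)] is stable under translation of [f], at the price of a
    larger [C] and a doubled [a]. It guarantees at every stage the integrability that Fubini needs
    for a signed [f]. *)
Lemma prod_int_sum_law n (f : R -> R) (a C : R) : 0 < a ->
  measurable_fun setT f -> (forall x, `|f x| <= C * expR (a * x ^+ 2)) ->
  prod_int rho (fun t : n.-tuple R => (f (S_N t))%:E) =
  (\int[sum_law rho n]_x (f x)%:E)%E.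
Proof.
move=> a0; elim: n f C a a0 => [|n IH] f C a a0 mf fle.
  rewrite /= integral_dirac//; last by apply/measurable_EFinP.
  by rewrite diracT mul1e /S_N big_nil.
have intf := integrable_sum_law n.+1 _ _ _ a0 mf fle.
rewrite prod_intS sum_lawS integral_convolution//; apply: eq_integral => x _.
under [X in prod_int _ X]eq_fun do rewrite /S_N big_cons.
have a20 : 0 < 2 * a by rewrite mulr_gt0.
apply: (IH (fun y => f (x + y)) (C * expR (2 * a * x ^+ 2)) (2 * a)) => //.
  by apply: measurableT_comp => //; exact: measurable_funD.
move=> y; apply: (le_trans (fle _)); rewrite -mulrA ler_wpM2l//.
  by have := le_trans (normr_ge0 _) (fle 0); rewrite pmulr_lge0// expR_gt0.
by rewrite -expRD ler_expR scaled_sqrD_le2// ltW.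
Qed.

Lemma sum_law_mgf n (t l : R) : (\int[rho]_x (expR (x * t))%:E = l%:E)%E ->
  (\int[sum_law rho n]_x (expR (x * t))%:E = (l ^+ n)%:E)%E.
Proof.
move=> rl; have mexp : measurable_fun setT (fun x : R => (expR (x * t))%:E).
  apply/measurable_EFinP; apply: measurableT_comp => //; exact: measurable_funM.
elim: n => [|n IH].
  by rewrite /= integral_dirac// diracT mul1e mul0r expR0.
rewrite sum_lawS ge0_integral_convolution//.
under eq_integral => x _.
  under eq_integral => y _ do rewrite mulrDl expRD EFinM.
  rewrite ge0_integralZl// IH; over.
rewrite ge0_integralZr//; last first.
  by rewrite -IH integral_ge0// => y _; rewrite lee_fin expR_ge0.
by rewrite rl exprS EFinM.
Qed.

End LawOfSum.

(** * The Hubbard-Stratonovich transform *)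

Section Gaussian.
Context {R : realType}.
Notation leb := (@lebesgue_measure R).

(** The standard deviation for which the normal density is proportional to
    [expR (- c * (x - m) ^+ 2)]. *)
Let sigma (c : R) := Num.sqrt (2 * c)^-1.

Let sigma2 (c : R) : 0 < c -> sigma c ^+ 2 = (2 * c)^-1.
Proof. by move=> c0; rewrite sqr_sqrtr// invr_ge0 mulr_ge0// ltW. Qed.

Let sigma_neq0 (c : R) : 0 < c -> sigma c != 0.
Proof. by move=> c0; rewrite gt_eqF// sqrtr_gt0 invr_gt0 mulr_gt0. Qed.

Let normal_pdf_exp (c m x : R) : 0 < c ->
  expR (- c * (x - m) ^+ 2) = Num.sqrt (pi / c) * normal_pdf m (sigma c) x.
Proof.
move=> c0; rewrite normal_pdfE ?sigma_neq0// /normal_peak /normal_fun sigma2//.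
rewrite (_ : (2 * c)^-1 * pi *+ 2 = pi / c); last first.
  by rewrite -mulr_natr; field; rewrite gt_eqF.
rewrite mulVKf; last by rewrite gt_eqF// sqrtr_gt0 divr_gt0// pi_gt0.
congr expR; rewrite -mulr_natr; field; rewrite gt_eqF//.
Qed.

Lemma lebesgue_measure_setT_neq0 : leb setT != 0%E.
Proof.
have := @lebesgue_measure_itv R `]-oo, +oo[%R; rewrite set_itvNyy/= => ->.
by [].
Qed.

Lemma integrable_gaussian (c m : R) : 0 < c ->
  leb.-integrable setT (fun x => (expR (- c * (x - m) ^+ 2))%:E).
Proof.
move=> c0; under eq_fun do rewrite normal_pdf_exp// EFinM.
by apply: integrableZl => //; exact: integrable_normal_pdf.
Qed.

Lemma integral_gaussian (c m : R) : 0 < c ->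
  (\int[leb]_x (expR (- c * (x - m) ^+ 2))%:E = (Num.sqrt (pi / c))%:E)%E.
Proof.
move=> c0; under eq_integral do rewrite normal_pdf_exp// EFinM.
rewrite integralZl//; last exact: integrable_normal_pdf.
by rewrite integral_normal_pdf mule1.
Qed.

End Gaussian.

Section HubbardStratonovich.
Context {R : realType}.
Notation leb := (@lebesgue_measure R).
Variables (rho : probability R R) (J h : R).
Hypothesis J_gt0 : 0 < J.
Hypothesis mgf : forall a b : R, 0 < a ->
  (\int[rho]_x (expR (a * x ^+ 2 / 2 + b * x))%:E < +oo)%E.

Lemma sqexp_int_of_mgf (a : R) : 0 < a ->
  (\int[rho]_x (expR (a * x ^+ 2))%:E < +oo)%E.
Proof.
move=> a0; have := @mgf (2 * a) 0; rewrite mulr_gt0// => /(_ isT).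
under eq_integral => x _.
  rewrite (_ : _ + _ = a * x ^+ 2); last by field.
  over.
by [].
Qed.

Lemma exp_int_of_mgf (c : R) :
  rho.-integrable setT (EFin \o (fun s => expR (c * s))).
Proof.
have mexp (a : R) : measurable_fun setT (EFin \o (fun s : R => expR (a * s))).
  by apply/measurable_EFinP; apply: measurableT_comp => //; exact: measurable_funM.
apply/integrableP; split; first exact: mexp.
apply: le_lt_trans (@mgf 1 c ltr01); apply: ge0_le_integral => //.
- exact: measurableT_comp.
- apply/measurable_EFinP; apply: measurableT_comp => //; apply: measurable_funD.
    by do 2 (apply: measurable_funM => //); exact: measurable_funX.
  exact: measurable_funM.
- move=> x _; rewrite /= ger0_norm ?expR_ge0// lee_fin ler_expR lerDr.
  by rewrite mul1r divr_ge0// sqr_ge0.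
Qed.

Lemma fCW_tilted_moment x :
  fCW rho J h x = - (J / 2) * x ^+ 2 + ln (tilted_moment rho 0 (J * x + h)).
Proof.
rewrite /fCW /tilted_moment /Rintegral; congr (_ + ln (fine _)).
by apply: eq_integral => s _; rewrite expr0 mul1r.
Qed.

Lemma Cn_fCW n : Cn n (fCW rho J h).
Proof.
rewrite (_ : fCW rho J h =
    (fun x => cst (- (J / 2)) x * (x * x) + ln (tilted_moment rho 0 (J * x + h)))).
  apply: CnD; first by apply: CnM; [exact: Cn_cst|apply: CnM; exact: Cn_id].
  apply: Cn_ln; first by move=> x; exact: tilted_moment0_gt0 exp_int_of_mgf _.
  (* Differentiation raises the order of the moment, so the induction must hold for all orders
     [j]. *)
  elim: n 0%N => // n IH j.
  apply: (Cn_derive _ _ (fun x => tilted_moment rho j.+1 (J * x + h) * J)).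
    move=> x; have dl : is_derive x (1:R) (fun x : R => J * x + h) J.
      rewrite -[X in is_derive _ _ _ X]addr0.
      apply: (@is_deriveD _ _ _ (fun x : R => J * x) (cst h)).
      rewrite -[X in is_derive _ _ _ X]mulr1.
      exact: (@is_deriveZ _ _ _ (@id R) J x 1 1).
    have dm := is_derive_tilted_moment rho exp_int_of_mgf j (J * x + h).
    exact: (@is_derive1_comp _ (tilted_moment rho j) (fun x : R => J * x + h)).
  by apply: CnM; [exact: IH|exact: Cn_cst].
by apply/funext => x; rewrite fCW_tilted_moment expr2.
Qed.

Lemma continuous_fCW : continuous (fCW rho J h).
Proof. exact: Cn_continuous (Cn_fCW 1). Qed.

Variable N : nat.
Hypothesis N_gt0 : (0 < N)%N.
Notation nu := (sum_law rho N).
Let NR : 0 < N%:R :> R. Proof. by rewrite ltr0n. Qed.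

Definition boltzmann (u : R) : R := expR (J / (2 * N%:R) * u ^+ 2 + h * u).

Lemma boltzmannE (t : N.-tuple R) : expR (- H_N J h t) = boltzmann (S_N t).
Proof. by rewrite /boltzmann /H_N; congr expR; ring. Qed.

(** Young's inequality absorbs the linear term [h * u], giving the growth bound required by
    [prod_int_sum_law]. *)
Lemma boltzmann_le u :
  boltzmann u <= expR (h ^+ 2 / 2) * expR ((J / (2 * N%:R) + 1 / 2) * u ^+ 2).
Proof.
rewrite -expRD ler_expR -subr_ge0 (_ : _ - _ = (h - u) ^+ 2 / 2); last first.
  by field; rewrite gt_eqF.
by rewrite divr_ge0// sqr_ge0.
Qed.

Lemma measurable_boltzmann : measurable_fun setT boltzmann.
Proof.
apply: measurableT_comp => //; apply: measurable_funD; last exact: measurable_funM.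
by apply: measurable_funM => //; exact: measurable_funX.
Qed.

Let rate_gt0 : 0 < J / (2 * N%:R) + 1 / 2.
Proof. by rewrite addr_gt0// divr_gt0// mulr_gt0. Qed.

Lemma integrable_boltzmann : nu.-integrable setT (EFin \o boltzmann).
Proof.
apply: (integrable_sum_law rho sqexp_int_of_mgf N _ _ _ rate_gt0 measurable_boltzmann).
by move=> u; rewrite ger0_norm ?expR_ge0//; exact: boltzmann_le.
Qed.

Lemma gibbs_expectE (g : R -> R) (C : R) : measurable_fun setT g ->
  (forall x, `|g x| <= C) ->
  gibbs_expect rho J h g N =
  (\int[nu]_u (g (u / N%:R) * boltzmann u)) / (\int[nu]_u boltzmann u).
Proof.
move=> mg gC; rewrite /gibbs_expect /Z_N /m_N; congr (fine _ / fine _).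
  under [X in prod_int _ X]eq_fun do rewrite boltzmannE.
  apply: (prod_int_sum_law rho sqexp_int_of_mgf N
    (fun u => g (u / N%:R) * boltzmann u) _ (C * expR (h ^+ 2 / 2)) rate_gt0).
    apply: measurable_funM; last exact: measurable_boltzmann.
    by apply: measurableT_comp => //; exact: measurable_funM.
  move=> u; rewrite normrM (ger0_norm (expR_ge0 _)).
  by rewrite -[leRHS]mulrA; apply: ler_pM => //; exact: boltzmann_le.
under [X in prod_int _ X]eq_fun do rewrite boltzmannE.
apply: (prod_int_sum_law rho sqexp_int_of_mgf N
  boltzmann _ (expR (h ^+ 2 / 2)) rate_gt0); first exact: measurable_boltzmann.
by move=> u; rewrite ger0_norm ?expR_ge0//; exact: boltzmann_le.
Qed.

(* For [c = N J / 2], completing the square makes [smoothed c (u, x)] the exponential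
   of a function that is affine in [u] (lemma [smoothedE]): this is the
   Hubbard-Stratonovich transform. *)
Definition smoothed (c : R) (p : R * R) : R :=
  boltzmann p.1 * expR (- c * (p.2 - p.1 / N%:R) ^+ 2).

Lemma smoothed_ge0 c p : 0 <= smoothed c p.
Proof. by rewrite mulr_ge0 ?expR_ge0. Qed.

Lemma measurable_smoothed c : measurable_fun setT (smoothed c).
Proof.
apply: measurable_funM.
  by apply: measurableT_comp => //; exact: measurable_boltzmann.
apply: measurableT_comp => //; apply: measurable_funM => //.
by apply: measurable_funX; apply: measurable_funB => //; exact: measurable_funM.
Qed.

Lemma integral_smoothed c u : 0 < c ->
  (\int[leb]_x (smoothed c (u, x))%:E = (Num.sqrt (pi / c) * boltzmann u)%:E)%E.
Proof.
move=> c0; under eq_integral do rewrite /smoothed/= EFinM.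
rewrite integralZl//; last exact: integrable_gaussian.
by rewrite integral_gaussian// -EFinM mulrC.
Qed.

Lemma integrable_smoothed c : 0 < c ->
  (nu \x leb)%E.-integrable setT (EFin \o smoothed c).
Proof.
move=> c0; apply/integrable12ltyP.
  by apply/measurable_EFinP; exact: measurable_smoothed.
under eq_integral => u _.
  under eq_integral do rewrite gee0_abs ?lee_fin ?smoothed_ge0//.
  rewrite /= integral_smoothed// EFinM; over.
rewrite integralZl//; last exact: integrable_boltzmann.
rewrite lte_mul_pinfty// ?lee_fin ?sqrtr_ge0//.
exact: integrable_lty integrable_boltzmann.
Qed.

Let c0 := N%:R * J / 2.
Let c0_gt0 : 0 < c0. Proof. by rewrite divr_gt0// mulr_gt0. Qed.

Lemma smoothedE u x :
  smoothed c0 (u, x) = expR (- (N%:R * (J / 2) * x ^+ 2)) * expR (u * (J * x + h)).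
Proof.
rewrite /smoothed /boltzmann/= -!expRD; congr expR; rewrite /c0.
by field; rewrite gt_eqF.
Qed.

(** Once the exponent is affine in [u], the integral is a moment generating function of the sum,
    hence the [N]-th power of that of [rho] at [J * x + h]. This is where [N f] appears. *)
Lemma integral_smoothed_sum_law x :
  (\int[nu]_u (smoothed c0 (u, x))%:E = (expR (N%:R * fCW rho J h x))%:E)%E.
Proof.
under eq_integral do rewrite smoothedE EFinM.
have l0 := tilted_moment0_gt0 rho exp_int_of_mgf (J * x + h).
have il := tilted_moment_integrable rho exp_int_of_mgf 0 (J * x + h).
rewrite ge0_integralZl//; last first.
  apply/measurable_EFinP; apply: measurableT_comp => //; exact: measurable_funM.
rewrite (sum_law_mgf rho N _ (tilted_moment rho 0 (J * x + h))); last first.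
  rewrite /tilted_moment /Rintegral fineK ?(integrable_fin_num _ il)//.
  by apply: eq_integral => s _; rewrite expr0 mul1r.
rewrite -EFinM fCW_tilted_moment; congr EFin.
rewrite mulrDr expRD; congr (expR _ * _); first by ring.
by rewrite expRM_natl lnK.
Qed.

Lemma integrable_bounded_smoothed (phi : R * R -> R) (C c : R) : 0 < c ->
  measurable_fun setT phi -> (forall p, `|phi p| <= C) ->
  (nu \x leb)%E.-integrable setT (EFin \o (fun p => phi p * smoothed c p)).
Proof.
move=> cp mphi phiC.
have iC : (nu \x leb)%E.-integrable setT (EFin \o (fun p => C * smoothed c p)).
  exact: (integrableZl measurableT C (integrable_smoothed c cp)).
apply: le_integrable iC => //.
  by apply/measurable_EFinP; apply: measurable_funM => //; exact: measurable_smoothed.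
move=> p _; rewrite lee_fin normrM [in leRHS]normrM ler_wpM2r//.
by rewrite (le_trans (phiC p))// ler_norm.
Qed.

(** Both expectations are integrals against the same joint density on pairs [(u, x)], where [x] is
    [u / N] plus a Gaussian. When [x] and [u / N] are [d]-close, the hypothesis on [g] applies, [o]
    marking the points [x] without good control; otherwise the difference is at most [2 * C] and the
    Gaussian tail takes over. *)
Lemma gibbs_smoothing (g o : R -> R) (C e d : R) : 0 < d -> 0 <= e ->
  measurable_fun setT g -> (forall x, `|g x| <= C) ->
  measurable_fun setT o -> (forall x, 0 <= o x <= 1) ->
  (forall m x, `|x - m| < d -> `|g m - g x| <= e + 2 * C * o x) ->
  let w x := expR (N%:R * fCW rho J h x) in
  [/\ leb.-integrable setT (EFin \o w), 0 < \int[leb]_x w x &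
  `|gibbs_expect rho J h g N - (\int[leb]_x (g x * w x)) / (\int[leb]_x w x)| <=
  e + 2 * C * ((\int[leb]_x (o x * w x)) / (\int[leb]_x w x))
    + 2 * C * Num.sqrt 2 * expR (- (N%:R * J / 4 * d ^+ 2))].
Proof.
move=> d0 e0 mg gC mo o01 go w.
have C0 : 0 <= C by apply: le_trans (gC 0).
have oC x : `|o x| <= 1 by rewrite ger0_norm; have /andP[] := o01 x.
pose P := (nu \x leb)%E.
pose K := smoothed c0.
pose c1 := N%:R * J / 4.
have c1_gt0 : 0 < c1 by rewrite divr_gt0// mulr_gt0.
(* [Ex] and [Eu] below compute the two marginals of the density [K]: [w] in [x], and the Gibbs
   weight in [u] up to the Gaussian normalization. *)
pose E (phi : R * R -> R) := \int[P]_p (phi p * K p).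
have mgN : measurable_fun setT (fun p : R * R => g (p.1 / N%:R)).
  by apply: measurableT_comp => //; exact: measurable_funM.
have mgx : measurable_fun setT (fun p : R * R => g p.2) by exact: measurableT_comp.
have mox : measurable_fun setT (fun p : R * R => o p.2) by exact: measurableT_comp.
have Ex (phi : R -> R) (B : R) : measurable_fun setT phi -> (forall x, `|phi x| <= B) ->
    E (fun p => phi p.2) = \int[leb]_x (phi x * w x).
  move=> mphi phiB.
  have mphi2 : measurable_fun setT (fun p : R * R => phi p.2) by exact: measurableT_comp.
  have iphi := integrable_bounded_smoothed _ _ _ c0_gt0 mphi2 (fun p => phiB p.2).
  rewrite /E /Rintegral -[in LHS](integral21_prod_meas1 iphi); congr fine.
  apply: eq_integral => x _; rewrite /fubini_G/=.
  under eq_integral do rewrite EFinM.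
  have iK : nu.-integrable setT (fun u => (K (u, x))%:E).
    apply/integrableP; split.
      apply/measurable_EFinP; apply: measurableT_comp (measurable_smoothed c0) _.
      exact: pair2_measurable.
    under eq_integral do rewrite gee0_abs ?lee_fin ?smoothed_ge0//.
    by rewrite integral_smoothed_sum_law ltry.
  by rewrite integralZl// integral_smoothed_sum_law -EFinM.
have Eu (phi : R -> R) (B : R) : measurable_fun setT phi -> (forall x, `|phi x| <= B) ->
    E (fun p => phi p.1) = Num.sqrt (pi / c0) * \int[nu]_u (phi u * boltzmann u).
  move=> mphi phiB.
  have mphi1 : measurable_fun setT (fun p : R * R => phi p.1) by exact: measurableT_comp.
  have iphi := integrable_bounded_smoothed _ _ _ c0_gt0 mphi1 (fun p => phiB p.1).
  rewrite -RintegralZl//; last first.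
    have iB := integrableZl measurableT B integrable_boltzmann.
    apply: le_integrable iB => //.
      by apply/measurable_EFinP; apply: measurable_funM => //; exact: measurable_boltzmann.
    move=> u _; rewrite /= lee_fin normrM [in leRHS]normrM ler_wpM2r//.
    by rewrite (le_trans (phiB u))// ler_norm.
  rewrite /E /Rintegral -[in LHS](integral12_prod_meas1 iphi); congr fine.
  apply: eq_integral => u _; rewrite /fubini_F/=.
  under eq_integral do rewrite EFinM.
  have iK : leb.-integrable setT (fun x => (K (u, x))%:E).
    apply/integrableP; split.
      apply/measurable_EFinP; apply: measurableT_comp (measurable_smoothed c0) _.
      exact: pair1_measurable.
    under eq_integral do rewrite gee0_abs ?lee_fin ?smoothed_ge0//.
    by rewrite integral_smoothed// ltry.
  by rewrite integralZl// integral_smoothed// -EFinM mulrCA.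
have mcst : measurable_fun setT (cst (1 : R)) by [].
have cst1 (x : R) : `|cst (1 : R) x| <= 1 by rewrite normr1.
have s_gt0 : 0 < Num.sqrt (pi / c0) by rewrite sqrtr_gt0 divr_gt0// pi_gt0.
have W0 : E (fun=> 1) = \int[leb]_x w x.
  rewrite (Ex (cst 1) 1)//; by apply: eq_Rintegral => x _; rewrite mul1r.
have WZ : \int[leb]_x w x = Num.sqrt (pi / c0) * \int[nu]_u boltzmann u.
  rewrite -W0 (Eu (cst 1) 1)//; congr (_ * _).
  by apply: eq_Rintegral => x _; rewrite mul1r.
have iK := integrable_smoothed c0 c0_gt0.
have iw : leb.-integrable setT (EFin \o w).
  have mw : measurable_fun setT w.
    apply: measurableT_comp => //; apply: measurable_funM => //.
    exact: continuous_measurable_fun continuous_fCW.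
  apply/integrableP; split; first by apply/measurable_EFinP.
  have -> : (\int[leb]_x `|(EFin \o w) x| =
      \int[leb]_x \int[nu]_u `|(EFin \o smoothed c0) (u, x)|)%E.
    apply: eq_integral => x _; rewrite gee0_abs ?lee_fin ?expR_ge0//=.
    rewrite -integral_smoothed_sum_law.
    by apply: eq_integral => u _; rewrite ger0_norm ?smoothed_ge0.
  by apply/integrable21ltyP => //; case/integrableP : iK.
have W_gt0 : 0 < \int[leb]_x w x.
  apply: Rintegral_gt0 => //; last by move=> x; exact: expR_gt0.
  exact: lebesgue_measure_setT_neq0.
split => //.
(* Half of the exponent of [K] is spent on [expR (- c1 * d ^+ 2)] when
   [d <= `|x - u / N%:R|]; what remains is [K2], still integrable. *)
pose K2 := smoothed c1.
have iK2 := integrable_smoothed c1 c1_gt0.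
(* Halving the rate from [c0] to [c1] multiplies the Gaussian integral [sqrt (pi / c)] by
   [sqrt 2]. *)
have WK2 : \int[P]_p K2 p = Num.sqrt 2 * \int[leb]_x w x.
  rewrite WZ mulrA -sqrtrM// -RintegralZl//; last exact: integrable_boltzmann.
  rewrite /Rintegral -(integral12_prod_meas1 iK2); congr fine.
  apply: eq_integral => u _; rewrite /fubini_F/= integral_smoothed//.
  congr ((Num.sqrt _ * _)%:E); rewrite /c1 /c0; field.
  by rewrite !gt_eqF.
have ig1 := integrable_bounded_smoothed _ _ _ c0_gt0 mgN (fun p => gC (p.1 / N%:R)).
have ig2 := integrable_bounded_smoothed _ _ _ c0_gt0 mgx (fun p => gC p.2).
have io := integrable_bounded_smoothed _ _ _ c0_gt0 mox (fun p => oC p.2).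
have mgn : measurable_fun setT (fun u : R => g (u / N%:R)).
  by apply: measurableT_comp => //; exact: measurable_funM.
rewrite (gibbs_expectE g C)//.
have -> : (\int[nu]_u (g (u / N%:R) * boltzmann u)) / (\int[nu]_u boltzmann u) =
    E (fun p => g (p.1 / N%:R)) / \int[leb]_x w x.
  rewrite (Eu (fun u => g (u / N%:R)) C)// WZ -mulf_div divff ?mul1r//.
  by rewrite gt_eqF.
rewrite -(Ex g C)// -(Ex o 1)// -mulrBl normrM normfV (gtr0_norm W_gt0).
rewrite ler_pdivrMr// [leRHS]mulrDl [X in _ <= X + _]mulrDl.
set eta := expR _.
have -> : 2 * C * (E (fun p => o p.2) / \int[leb]_x w x) * \int[leb]_x w x =
    2 * C * E (fun p => o p.2) by rewrite -mulrA divfK// gt_eqF.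
have -> : 2 * C * Num.sqrt 2 * eta * \int[leb]_x w x = 2 * C * eta * \int[P]_p K2 p.
  by rewrite WK2; ring.
have EK : E (fun=> 1) = \int[P]_p K p by apply: eq_Rintegral => p _; rewrite mul1r.
rewrite -W0 EK.
have ieK := integrableZl measurableT e iK.
have ioK := integrableZl measurableT (2 * C) io.
have iK2C := integrableZl measurableT (2 * C * eta) iK2.
rewrite /E -RintegralB// -!RintegralZl//.
have iAB : P.-integrable setT (EFin \o (fun p => e * K p + 2 * C * (o p.2 * K p))).
  exact: (integrableD measurableT ieK ioK).
have iABC : P.-integrable setT (EFin \o (fun p => e * K p + 2 * C * (o p.2 * K p)
    + 2 * C * eta * K2 p)).
  exact: (integrableD measurableT iAB iK2C).
rewrite -RintegralD// -RintegralD//.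
have ig12 : P.-integrable setT (EFin \o (fun p => g (p.1 / N%:R) * K p - g p.2 * K p)).
  exact: (integrableB measurableT ig1 ig2).
apply: le_trans (le_normr_Rintegral _ ig12) _ => //.
apply: le_Rintegral => //.
- exact: integrable_norm.
move=> [u x] _ /=; rewrite -mulrBl normrM (ger0_norm (smoothed_ge0 _ _)).
have K0 := smoothed_ge0 c0 (u, x); have K20 := smoothed_ge0 c1 (u, x).
have [xd|xd] := ltP `|x - u / N%:R| d.
  apply: (@le_trans _ _ ((e + 2 * C * o x) * K (u, x))).
    by rewrite ler_wpM2r//; exact: go.
  by rewrite mulrDl mulrA lerDl !mulr_ge0// expR_ge0.
apply: (@le_trans _ _ (2 * C * eta * K2 (u, x))); last first.
  have /andP[ox0 _] := o01 x.
  rewrite lerDr; apply: addr_ge0; apply: mulr_ge0 => //.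
    by rewrite mulr_ge0.
  exact: mulr_ge0.
rewrite -mulrA; apply: ler_pM => //.
  by rewrite (le_trans (ler_normB _ _))// mulr_natl mulr2n lerD.
rewrite /K /K2 /smoothed/= [leRHS]mulrCA ler_wpM2l ?expR_ge0// /eta -expRD ler_expR.
have : d ^+ 2 <= (x - u / N%:R) ^+ 2.
  by rewrite -[leRHS]real_normK ?num_real// lerXn2r ?nnegrE// ltW.
rewrite -(ler_pM2l c1_gt0) /c0 /c1; lra.
Qed.

End HubbardStratonovich.

(** * Laplace's method at one maximum *)

Section Affine.
Context {R : realType}.
Notation leb := (@lebesgue_measure R).

Lemma measurable_affine (a c : R) :
  measurable_fun setT (fun y : R => a + c * y).
Proof. by apply: measurable_funD => //; exact: measurable_funM. Qed.

(** By uniqueness of Lebesgue measure, it suffices to compare lengths of half-open intervals. *)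
Lemma lebesgue_measure_affine (a c : R) (c0 : 0 <= c) (A : set R) :
  0 < c -> measurable A ->
  leb A = pushforward (mscale (NngNum c0) leb)
    (fun y : R => (a + c * y)%R : measurableTypeR R) A.
Proof.
move=> c_gt0 mA; have mf := measurable_affine a c.
apply: lebesgue_measure_unique => //= _ [[x y]] _ <-.
rewrite /pushforward /mscale/=.
rewrite (_ : _ @^-1` _ = `](x - a) / c, (y - a) / c]%classic); last first.
  by apply/seteqP; split => z /=; rewrite !in_itv/= ltr_pdivrMr// ler_pdivlMr//;
    move=> /andP[? ?]; apply/andP; split; lra.
rewrite !lebesgue_measure_itv/= !lte_fin ltr_pM2r ?invr_gt0// ltrD2r.
case: ifPn => _; last by rewrite mule0.
rewrite -!EFinD -EFinM; congr EFin; field; rewrite gt_eqF//.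
Qed.

Lemma ge0_integral_affine (F : R -> \bar R) (a c : R) : 0 < c ->
  measurable_fun setT F -> (forall x, 0 <= F x)%E ->
  (\int[leb]_x F x = c%:E * \int[leb]_y F (a + c * y)%R)%E.
Proof.
move=> c0 mF F0.
pose T : measurableTypeR R -> measurableTypeR R := fun y : R => a + c * y.
have mT : measurable_fun [set: measurableTypeR R] T by exact: measurable_affine.
have mFT : measurable_fun setT (fun y => F (T y)) by exact: measurableT_comp mF mT.
transitivity (\int[mscale (NngNum (ltW c0)) leb]_y F (T y))%E; last first.
  by rewrite ge0_integral_mscale.
have := @ge0_integral_pushforward _ _ (measurableTypeR R) (measurableTypeR R) R T mT (mscale (NngNum (ltW c0)) leb)
  setT F measurableT mF (fun y _ => F0 y).
rewrite preimage_setT => <-.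
by apply: eq_measure_integral => A mA _; exact: lebesgue_measure_affine.
Qed.

(** The nonnegative case is applied to the positive and negative parts, whose finite integrals may
    be subtracted. *)
Lemma Rintegral_affine (f : R -> R) (a c : R) : 0 < c ->
  leb.-integrable setT (EFin \o f) ->
  leb.-integrable setT (EFin \o (fun y => f (a + c * y))) /\
  \int[leb]_x f x = c * \int[leb]_y f (a + c * y).
Proof.
move=> c0 /integrableP[mf intf].
have mfc : measurable_fun setT (EFin \o (fun y => f (a + c * y))).
  exact: (measurableT_comp mf (measurable_affine a c)).
have ifc : leb.-integrable setT (EFin \o (fun y => f (a + c * y))).
  apply/integrableP; split => //.
  move: intf; rewrite (ge0_integral_affine (fun x => `|(EFin \o f) x|)%E a c)//; last exact: measurableT_comp.
  move=> H; rewrite ltey; apply/eqP => E; move: H.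
  by rewrite E gt0_muley ?lte_fin// ltxx.
split => //.
pose T (y : R) : R := a + c * y.
have /integrable_fin_num fp : leb.-integrable setT ((EFin \o f) \o T)^\+%E.
  exact: integrable_funepos.
have /integrable_fin_num fn : leb.-integrable setT ((EFin \o f) \o T)^\-%E.
  exact: integrable_funeneg.
move: (fp measurableT) (fn measurableT) => {fp fn}.
rewrite (funepos_comp (EFin \o f) T) (funeneg_comp (EFin \o f) T) => fp fn.
suff : fine (\int[leb]_x (EFin \o f) x)%E =
    c * fine (\int[leb]_y ((EFin \o f) \o T) y)%E by [].
rewrite integralE [in RHS]integralE.
rewrite (funepos_comp (EFin \o f) T) (funeneg_comp (EFin \o f) T).
rewrite (ge0_integral_affine (EFin \o f)^\+%E a c)//; last exact: measurable_funepos.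
rewrite (ge0_integral_affine (EFin \o f)^\-%E a c)//; last exact: measurable_funeneg.
rewrite -(fineK fp) -(fineK fn) -EFinM -EFinM -!EFinB/=.
by rewrite mulrBr.
Qed.

End Affine.

Section Laplace.
Context {R : realType}.
Notation leb := (@lebesgue_measure R).

Lemma expr_double_norm (t : R) k : `|t| ^+ k.*2 = t ^+ k.*2.
Proof. by rewrite -mul2n !exprM real_normK ?num_real. Qed.

Lemma exprn_double_ge0 (t : R) k : 0 <= t ^+ k.*2.
Proof. by rewrite -mul2n exprM exprn_ge0// sqr_ge0. Qed.

Lemma integrable_expR_even (c : R) k : 0 < c -> (0 < k)%N ->
  leb.-integrable setT (EFin \o (fun y => expR (- c * y ^+ k.*2))).
Proof.
move=> c0 k0; have ig := integrable_gaussian c 0 c0.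
apply: (le_integrable _ _ _ (integrableZl measurableT (expR c) ig)) => //.
  apply/measurable_EFinP; apply: measurableT_comp => //.
  by apply: measurable_funM => //; exact: measurable_funX.
move=> y _; rewrite /= lee_fin subr0 !ger0_norm ?mulr_ge0 ?expR_ge0//.
(* [y ^+ 2 <= 1 + y ^+ k.*2] reduces the claim to the Gaussian. *)
rewrite -expRD ler_expR -mul2n exprM.
have y0 := sqr_ge0 y; set z := y ^+ 2 in y0 *.
suff : z <= 1 + z ^+ k by move=> H; nra.
have [z1|z1] := leP z 1; first by rewrite (le_trans z1)// lerDl exprn_ge0.
by rewrite (@le_trans _ _ (z ^+ k))// ?lerDr// ler_eXnr// ltW.
Qed.

Lemma integrable_expRN_even k : (0 < k)%N ->
  leb.-integrable setT (EFin \o (fun y => expR (- y ^+ k.*2))).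
Proof.
move=> k0; have := integrable_expR_even 1 k ltr01 k0.
by congr (integrable _ _ _); apply/funext => y /=; rewrite mulN1r.
Qed.

Lemma powR_root (x : R) m : 0 <= x -> (0 < m)%N -> (x `^ (m%:R^-1)) ^+ m = x.
Proof.
move=> x0 m0; rewrite -powR_mulrn ?powR_ge0// -powRrM mulVf ?powRr1//.
by rewrite pnatr_eq0 -lt0n.
Qed.

Section Local.
Variables (f phi : R -> R) (mu a C : R) (k : nat).
Hypotheses (k0 : (0 < k)%N) (a0 : 0 < a).
Hypotheses (cf : continuous f) (cphi : continuous phi) (phiC : forall x, `|phi x| <= C).
Hypothesis iw : forall n : nat,
  leb.-integrable setT (EFin \o (fun x => expR (n.+1%:R * (f x - f mu)))).
Hypothesis taylor : forall e : R, 0 < e -> exists2 d : R, 0 < d &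
  forall t : R, `|t| < d -> `|f (mu + t) - f mu + a * t ^+ k.*2| <= e * t ^+ k.*2.

(* The substitution [x = mu + y / s n] turns [n.+1 (f x - f mu)] into a quantity
   tending to [- y ^+ k.*2]. *)
Let s (n : nat) : R := (a * n.+1%:R) `^ (k.*2%:R^-1).

Let s0 n : 0 < s n. Proof. by rewrite powR_gt0// mulr_gt0. Qed.

Let sX n : (s n) ^+ k.*2 = a * n.+1%:R.
Proof. by rewrite powR_root ?double_gt0// mulr_ge0// ltW. Qed.

Let scaled n (y : R) : n.+1%:R * (y / s n) ^+ k.*2 = y ^+ k.*2 / a.
Proof. by rewrite expr_div_n sX invfM mulrCA (mulrCA n.+1%:R) mulfV ?mulr1. Qed.

Let near_scaled (y d : R) : 0 < d -> \forall n \near \oo, `|y / s n| < d.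
Proof.
move=> d0.
have := nbhs_infty_ger ((`|y| / d) ^+ k.*2 / a); apply: filterS => n nge.
rewrite normrM normfV (gtr0_norm (s0 n)) ltr_pdivrMr// mulrC -ltr_pdivrMr//.
rewrite ltNge; apply/negP => le.
have : (s n) ^+ k.*2 <= (`|y| / d) ^+ k.*2.
  by rewrite lerXn2r ?nnegrE ?divr_ge0 ?(ltW (s0 n)) ?(ltW d0).
rewrite sX mulrC -ler_pdivlMr// leNgt => /negP; apply.
by apply: (le_lt_trans nge); rewrite ltr_nat.
Qed.

(** Dominated convergence after rescaling by [s n]. Every radius below [d0] is allowed, so that one
    radius can later serve all the maxima. *)
Lemma laplace_local : exists2 d0 : R, 0 < d0 & forall d, 0 < d -> d <= d0 ->
  (fun n => s n * \int[leb]_(x in ball mu d)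
     (phi x * expR (n.+1%:R * (f x - f mu)))) @ \oo -->
  phi mu * \int[leb]_y expR (- y ^+ k.*2).
Proof.
(* With tolerance [a / 2], half of the leading term survives in the ball, which gives the dominating
   function [C * expR (- (1 / 2) * y ^+ k.*2)], independent of [n]. *)
have [d1 d10 H1] := taylor (a / 2) (divr_gt0 a0 (ltr0n _ 2)).
exists d1 => // d d_gt0 dd1.
have C0 : 0 <= C by apply: le_trans (phiC 0).
pose B := ball mu d.
have mB : measurable (B : set R) by apply: open_measurable; exact: ball_open.
have mphi := continuous_measurable_fun cphi.
have mf := continuous_measurable_fun cf.
pose G n x := phi x * expR (n.+1%:R * (f x - f mu)).
have mG n : measurable_fun setT (G n).
  apply: measurable_funM => //; apply: measurableT_comp => //.
  by apply: measurable_funM => //; exact: measurable_funB.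
have iG n : leb.-integrable setT (EFin \o (G n \_ B)).
  have iGT : leb.-integrable setT (EFin \o G n).
    have iC := integrableZl measurableT C (iw n).
    apply: le_integrable iC => //; first by apply/measurable_EFinP; exact: mG.
    move=> x _; rewrite /= lee_fin normrM [in leRHS]normrM ler_wpM2r//.
    by rewrite (le_trans (phiC x))// ler_norm.
  have iGB : leb.-integrable (B : set R) (EFin \o G n).
    by apply: (integrableS _ _ _ iGT) => //; exact: mB.
  have := proj1 (@integrable_mkcond _ _ _ leb B (EFin \o G n) mB) iGB.
  by congr (integrable _ _ _); apply/funext => x; rewrite /= !patchE; case: ifP.
(* Extension by zero outside the ball keeps the domain of integration fixed while the rescaled ball
   grows. *)
pose F n y := (G n \_ B) (mu + (s n)^-1 * y).
have sF n : s n * \int[leb]_(x in B) G n x = \int[leb]_y F n y.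
  have sV : 0 < (s n)^-1 by rewrite invr_gt0.
  have [_ E] := Rintegral_affine _ mu _ sV (iG n).
  by rewrite Rintegral_mkcond E mulVKf// gt_eqF.
under eq_fun do rewrite sF.
have iF n : leb.-integrable setT (EFin \o F n).
  have sV : 0 < (s n)^-1 by rewrite invr_gt0.
  by have [] := Rintegral_affine _ mu _ sV (iG n).
have FE n y : `|y / s n| < d ->
    F n y = phi (mu + y / s n) * expR (n.+1%:R * (f (mu + y / s n) - f mu)).
  move=> yd; rewrite /F patchE (mulrC _ y) ifT// inE /B -ball_normE/=.
  by rewrite opprD addNKr normrN.
have Fdom n y : `|F n y| <= C * expR (- (1 / 2) * y ^+ k.*2).
  have [yd|yd] := ltP `|y / s n| d; last first.
    rewrite /F patchE (mulrC _ y) ifF ?normr0 ?mulr_ge0 ?expR_ge0//.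
    apply/negbTE; rewrite notin_setE /B -ball_normE/=.
    by rewrite opprD addNKr normrN; apply/negP; rewrite -leNgt.
  rewrite FE// normrM (ger0_norm (expR_ge0 _)).
  apply: ler_pM => //; rewrite ler_expR.
  have := H1 _ (lt_le_trans yd dd1).
  set t := y / s n; rewrite ler_norml => /andP[_ ub].
  have := scaled n y; rewrite -/t; set Y := y ^+ _; set T := t ^+ _ in ub *.
  move=> TY; have {}ub : f (mu + t) - f mu <= - (a / 2) * T by lra.
  apply: (@le_trans _ _ (n.+1%:R * (- (a / 2) * T))).
    by rewrite ler_wpM2l.
  rewrite mulrCA TY le_eqVlt; apply/orP; left; apply/eqP.
  by field; rewrite gt_eqF.
have Fcvg y : F n y @[n --> \oo] --> phi mu * expR (- y ^+ k.*2).
  have y_cvg : (fun n => mu + y / s n) @ \oo --> mu.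
    apply/cvgrPdist_lt => e e0; have := near_scaled y e e0.
    by apply: filterS => n; rewrite opprD addNKr normrN.
  have q_cvg : (fun n => n.+1%:R * (f (mu + y / s n) - f mu)) @ \oo --> - y ^+ k.*2.
    apply/cvgrPdist_le => e e0.
    have Y0 := exprn_double_ge0 y k; set Y := y ^+ k.*2 in Y0 *.
    (* As [n.+1 * T = Y / a], this tolerance leaves an error [e * (Y / (Y + 1)) <= e]; the [+ 1]
       takes care of [y = 0]. *)
    have e'0 : 0 < e * a / (Y + 1) by rewrite divr_gt0 ?mulr_gt0// ltr_wpDl.
    have [d' d'0 H'] := taylor _ e'0.
    have := near_scaled y d' d'0; apply: filterS => n yd'.
    have := H' _ yd'; have := scaled n y.
    set t := y / s n; rewrite -/Y; set T := t ^+ _ => TY H.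
    rewrite (_ : - Y - _ = - (n.+1%:R * (f (mu + t) - f mu + a * T))); last first.
      by rewrite [in RHS]mulrDr (mulrCA _ a) TY (mulrC a) divfK ?gt_eqF//; ring.
    rewrite normrN normrM ger0_norm//.
    apply: (@le_trans _ _ (n.+1%:R * (e * a / (Y + 1) * T))); first by rewrite ler_wpM2l.
    rewrite mulrCA TY (_ : e * a / (Y + 1) * (Y / a) = e * (Y / (Y + 1))); last first.
      by field; rewrite !gt_eqF// ltr_wpDl.
    by rewrite -[leRHS]mulr1 ler_pM2l// ler_pdivrMr ?mul1r ?lerDl// ltr_wpDl.
  have : (fun n => phi (mu + y / s n) * expR (n.+1%:R * (f (mu + y / s n) - f mu)))
      @ \oo --> phi mu * expR (- y ^+ k.*2).
    apply: cvgM; first exact: (cvg_comp _ _ y_cvg (cphi mu)).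
    apply: (@cvg_comp _ _ _ (fun n : nat => n.+1%:R * (f (mu + y / s n) - f mu))
      expR _ _ _ q_cvg).
    exact: continuous_expR.
  apply: cvg_trans; apply: near_eq_cvg.
  by have := near_scaled y d d_gt0; apply: filterS => n yd; rewrite FE.
have iE : leb.-integrable setT (EFin \o (fun y => expR (- y ^+ k.*2))).
  exact: integrable_expRN_even.
have iL := integrableZl measurableT (phi mu) iE.
have half_gt0 : 0 < 1 / 2 :> R by rewrite divr_gt0.
have iD := integrableZl measurableT C (integrable_expR_even _ k half_gt0 k0).
rewrite -RintegralZl//.
apply: fine_cvg; rewrite fineK; last by apply: integrable_fin_num => //; exact: iL.
have [] := @dominated_convergence _ _ _ leb setT measurableT
  (fun n y => (F n y)%:E) (fun y => (phi mu * expR (- y ^+ k.*2))%:E)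
  (EFin \o (fun y => C * expR (- (1 / 2) * y ^+ k.*2))) => //.
- by move=> n; case/integrableP : (iF n).
- by case/integrableP : iL.
- by apply: aeW => y _; apply: cvg_EFin; [exact: nearW|exact: Fcvg].
- by apply: aeW => y n _; rewrite /= lee_fin; exact: Fdom.
Qed.

End Local.
End Laplace.

(** * Laplace's method with several maxima *)

Section Maximizers.
Context {R : realType}.

Lemma seq_radius (s : seq R) (P : R -> R -> Prop) :
  (forall x d d', P x d -> 0 < d' -> d' <= d -> P x d') ->
  (forall x, x \in s -> exists2 d : R, 0 < d & P x d) ->
  exists2 d : R, 0 < d & forall x, x \in s -> P x d.
Proof.
move=> Pmono; elim: s => [|y s IH] Ps; first by exists 1.
have [d1 d10 H1] := Ps y (mem_head _ _).
have [|d2 d20 H2] := IH; first by move=> x xs; apply: Ps; rewrite inE xs orbT.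
have m0 : 0 < Num.min d1 d2 by rewrite lt_min d10.
exists (Num.min d1 d2) => // x; rewrite inE => /predU1P[->|xs].
  by apply: Pmono H1 m0 _; rewrite ge_min lexx.
by apply: Pmono (H2 _ xs) m0 _; rewrite ge_min lexx orbT.
Qed.

Variables (f : R -> R) (c B : R).
Hypotheses (c0 : 0 < c) (cf : continuous f) (f_le : forall x, f x <= - c * x ^+ 2 + B).

(** The quadratic upper bound on [f] confines the search to a compact part of [A], where the extreme
    value theorem applies. *)
Lemma closed_max (A : set R) (x0 : R) : closed A -> A x0 ->
  exists2 m, A m & forall x, A x -> f x <= f m.
Proof.
move=> cA Ax0.
(* Beyond [K], [|x| >= 1] gives [x^2 >= |x|], and then [c * x^2 >= B - f x0]; the term [|x0|] keeps
   [x0] inside the segment. *)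
pose K := 1 + `|x0| + `|(B - f x0) / c|.
have small x : K < `|x| -> f x <= f x0.
  move=> Kx; apply: (le_trans (f_le x)).
  have x1 : 1 <= `|x| by rewrite (le_trans _ (ltW Kx))// /K -addrA lerDl addr_ge0.
  have : (B - f x0) / c <= `|x|.
    by rewrite (le_trans _ (ltW Kx))// (le_trans (ler_norm _))// lerDr addr_ge0.
  rewrite ler_pdivrMr// => H.
  have : `|x| <= `|x| ^+ 2 by rewrite expr2 ler_peMl.
  by rewrite real_normK ?num_real// => /(ler_wpM2l (ltW c0)) x2; lra.
have cAK : compact (A `&` `[- K, K]%classic).
  apply: (subclosed_compact _ (@segment_compact R (- K) K)) => //.
  by apply: closedI => //; exact: interval_closed.
have AK0 : (A `&` `[- K, K]%classic) !=set0.
  exists x0; split => //=; rewrite in_itv/= -ler_norml.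
  by rewrite /K addrAC lerDr addr_ge0.
have [m] := compact_EVT_max AK0 cAK (continuous_subspaceT cf).
rewrite inE => -[Am _] mmax; exists m => // x Ax.
have [xK|xK] := ltP K `|x|.
  apply: (le_trans (small _ xK)); apply: mmax; rewrite inE; split => //=.
  by rewrite in_itv/= -ler_norml /K addrAC lerDr addr_ge0.
by apply: mmax; rewrite inE; split => //=; rewrite in_itv/= -ler_norml.
Qed.

Variable M : seq R.
Hypothesis M_max : forall x, x \in M <-> (forall y, f y <= f x).

Lemma maximizer_exists : exists mu, mu \in M.
Proof.
have [m _ mmax] := closed_max setT 0 closedT I.
by exists m; apply/M_max => y; exact: mmax.
Qed.

(** The points at distance at least [d] from [M] form a closed set, on which [f] attains its
    maximum. If that value reached [f mu0], the point attaining it would lie in [M], at distance 0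
    from itself. *)
Lemma max_gap (mu0 d : R) : mu0 \in M -> 0 < d -> exists2 eta : R, 0 < eta &
  forall x, (forall mu, mu \in M -> d <= `|x - mu|) -> f x <= f mu0 - eta.
Proof.
move=> mu0M d0.
pose A := [set x : R | forall mu, mu \in M -> d <= `|x - mu|].
have cA : closed A.
  rewrite (_ : A = \bigcap_(mu in [set` M]) ~` (ball mu d)); last first.
    apply/seteqP; split => x /= Ax mu muM.
      by rewrite -ball_normE/= distrC; apply/negP; rewrite -leNgt; exact: Ax.
    by have := Ax mu muM; rewrite -ball_normE/= distrC => /negP; rewrite -leNgt.
  by apply: closed_bigI => mu _; apply: open_closedC; exact: ball_open.
have [[x0 Ax0]|noA] := pselect (exists x0, A x0); last first.
  by exists 1 => // x Ax; case: noA; exists x.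
have [m Am mmax] := closed_max A x0 cA Ax0.
exists (f mu0 - f m); last by move=> x Ax; rewrite opprB addrC subrK; exact: mmax.
rewrite subr_gt0 ltNge; apply/negP => le.
have mM : m \in M.
  by apply/M_max => y; apply: le_trans le; move/M_max : mu0M; apply.
by have := Am m mM; rewrite subrr normr0 leNgt d0.
Qed.

End Maximizers.

(** * Global asymptotics: contributions of all the maxima and of their complement *)

Section LaplaceMethod.
Context {R : realType}.
Notation leb := (@lebesgue_measure R).

Lemma cvg_powR_neg (r : R) : 0 < r -> (fun n => n.+1%:R `^ (- r)) @ \oo --> (0 : R).
Proof.
move=> r0; apply/cvgrPdist_lt => e e0.
have := nbhs_infty_ger (e^-1 `^ r^-1); apply: filterS => n nge.
rewrite sub0r normrN ger0_norm ?powR_ge0// powRN.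
rewrite invf_plt ?posrE ?powR_gt0//.
have -> : e^-1 = (e^-1 `^ r^-1) `^ r.
  by rewrite -powRrM mulVf ?gt_eqF// powRr1// invr_ge0 ltW.
rewrite gt0_ltr_powR ?nnegrE ?powR_ge0//.
by apply: (le_lt_trans nge); rewrite ltr_nat.
Qed.

(** The quadratic lower bound [x^2 / 2 <= expR x] beats the linear factor. *)
Lemma cvg_mul_expRN (eta K : R) : 0 < eta ->
  (fun n => n.+1%:R * expR (- eta * n%:R) * K) @ \oo --> (0 : R).
Proof.
move=> eta0; apply/cvgrPdist_le => e e0.
have := nbhs_infty_ger (2 * expR eta * `|K| / eta ^+ 2 / e); apply: filterS => n nge.
rewrite sub0r normrN normrM ger0_norm ?mulr_ge0 ?expR_ge0//.
have := expR_ge1Dxn 1 (mulr_ge0 (ltW eta0) (ler0n _ n.+1)).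
move=> E.
have {}E : (eta * n.+1%:R) ^+ 2 / 2 <= expR (eta * n.+1%:R).
  by apply: le_trans E; rewrite lerDr.
have -> : expR (- eta * n%:R) = expR eta / expR (eta * n.+1%:R).
  by rewrite -expRN -expRD; congr expR; rewrite -natr1; ring.
have n0 : 0 < n.+1%:R :> R by [].
rewrite mulrAC mulrA ler_pdivrMr ?expR_gt0//.
apply: (@le_trans _ _ (e * ((eta * n.+1%:R) ^+ 2 / 2))); last by rewrite ler_pM2l.
have {}nge : 2 * expR eta * `|K| / eta ^+ 2 / e <= n.+1%:R.
  by rewrite (le_trans nge)// ler_nat.
rewrite ler_pdivrMr// ler_pdivrMr ?exprn_gt0// in nge.
have := ler_pM2l n0 (2 * expR eta * `|K|) (n.+1%:R * e * eta ^+ 2).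
rewrite nge => H; move: H => /= H; lra.
Qed.

Variables (f : R -> R) (fs : R) (M : seq R) (k : R -> nat) (a : R -> R) (kstar : nat).
Hypotheses (cf : continuous f) (M_uniq : uniq M).
Hypothesis f_max : forall mu, mu \in M -> f mu = fs.
Hypothesis k_gt0 : forall mu, mu \in M -> (0 < k mu)%N.
Hypothesis k_le : forall mu, mu \in M -> (k mu <= kstar)%N.
Hypothesis a_gt0 : forall mu, mu \in M -> 0 < a mu.
Hypothesis taylor : forall mu, mu \in M -> forall e : R, 0 < e ->
  exists2 d : R, 0 < d & forall t : R, `|t| < d ->
  `|f (mu + t) - f mu + a mu * t ^+ (k mu).*2| <= e * t ^+ (k mu).*2.
Hypothesis gap : forall d : R, 0 < d -> exists2 eta : R, 0 < eta &
  forall x, (forall mu, mu \in M -> d <= `|x - mu|) -> f x <= fs - eta.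
Hypothesis iw : forall n : nat,
  leb.-integrable setT (EFin \o (fun x => expR (n.+1%:R * (f x - fs)))).
Hypothesis kstar_gt0 : (0 < kstar)%N.

(** The exponent of the flattest maxima, used to normalize every integral. *)
Let p : R := (kstar.*2)%:R^-1.

Definition far (d : R) : set R := [set x | forall mu, mu \in M -> d <= `|x - mu|].

(** Stated for an arbitrary list, so that measurability and additivity go by induction on it; the
    complement of [far d] is the case of [M]. *)
Definition near_seq (d : R) (s : seq R) : set R :=
  [set x | exists2 mu, mu \in s & ball mu d x].

Let measurable_ball (mu d : R) : measurable (ball mu d : set (measurableTypeR R)).
Proof. by apply: open_measurable; exact: ball_open. Qed.

Let near_seq_cons d mu s : near_seq d (mu :: s) = ball mu d `|` near_seq d s.
Proof.
apply/seteqP; split => x /=.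
  move=> [nu]; rewrite inE => /predU1P[->|nus] nux; first by left.
  by right; exists nu.
move=> [mux|[nu nus nux]]; first by exists mu => //; exact: mem_head.
by exists nu => //; rewrite inE nus orbT.
Qed.

Let measurable_near_seq d s : measurable (near_seq d s : set (measurableTypeR R)).
Proof.
elim: s => [|mu s IH].
  rewrite (_ : near_seq d [::] = set0); first exact: measurable0.
  by apply/seteqP; split => x // -[].
by rewrite near_seq_cons; apply: measurableU => //; exact: measurable_ball.
Qed.

Lemma far_setC d : far d = ~` near_seq d M.
Proof.
apply/seteqP; split => x /= H.
  by move=> [mu muM]; rewrite -ball_normE/= distrC ltNge H.
move=> mu muM; rewrite leNgt; apply/negP => xmu; apply: H.
by exists mu => //; rewrite -ball_normE/= distrC.
Qed.

Lemma measurable_far d : measurable (far d : set (measurableTypeR R)).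
Proof. by rewrite far_setC; apply: measurableC; exact: measurable_near_seq. Qed.

Let Rintegral_near_seq (G : R -> R) d s : uniq s ->
  leb.-integrable setT (EFin \o G) ->
  (forall x y, x \in s -> y \in s -> x != y -> 2 * d <= `|x - y|) ->
  \int[leb]_(x in near_seq d s) G x = \sum_(mu <- s) \int[leb]_(x in ball mu d) G x.
Proof.
move=> + iG; elim: s => [|mu s IH] /=.
  move=> _ _; rewrite big_nil (_ : near_seq d [::] = set0) ?Rintegral_set0//.
  by apply/seteqP; split => x // -[].
move=> /andP[mus us] sep; rewrite big_cons near_seq_cons Rintegral_setU.
- rewrite IH// => x y xs ys; apply: sep; by rewrite inE ?xs ?ys orbT.
- exact: measurable_ball.
- exact: measurable_near_seq.
- apply: (integrableS _ _ _ iG) => //; apply: measurableU; first exact: measurable_ball.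
  exact: measurable_near_seq.
rewrite disj_set2E; apply/eqP; rewrite -subset0 => x [mux [nu nus nux]].
have munu : mu != nu by apply: contraNneq mus => ->.
have := sep mu nu (mem_head _ _); rewrite inE nus orbT => /(_ isT munu).
rewrite leNgt => /negP; apply.
move: mux nux; rewrite -!ball_normE/= => mux nux.
rewrite (_ : mu - nu = (mu - x) - (nu - x)); last by ring.
by rewrite (le_lt_trans (ler_normB _ _))// mulr_natl mulr2n ltrD.
Qed.

Lemma laplace_far (phi : R -> R) (C d : R) : continuous phi ->
  (forall x, `|phi x| <= C) -> 0 < d ->
  (fun n => n.+1%:R `^ p * \int[leb]_(x in far d)
    (phi x * expR (n.+1%:R * (f x - fs)))) @ \oo --> (0 : R).
Proof.
move=> cphi phiC d0; have [eta eta0 f_gap] := gap d d0.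
have C0 : 0 <= C by apply: le_trans (phiC 0).
have mfar := measurable_far d.
pose w1 x := expR (1%:R * (f x - fs)).
have iw1 : leb.-integrable (far d : set (measurableTypeR R)) (EFin \o w1).
  by apply: (integrableS _ _ _ (iw 0%N)).
pose K := \int[leb]_(x in far d) w1 x.
have K0 : 0 <= K by apply: Rintegral_ge0 => x _; exact: expR_ge0.
(* Split [n.+1] as [n + 1]: the gap is applied [n] times, and the last factor
   [w1] gives integrability. *)
have key n : `|\int[leb]_(x in far d) (phi x * expR (n.+1%:R * (f x - fs)))| <=
    C * expR (- eta * n%:R) * K.
  have mphi := continuous_measurable_fun cphi.
  have mf := continuous_measurable_fun cf.
  have bd x : far d x -> `|phi x * expR (n.+1%:R * (f x - fs))| <=
      C * expR (- eta * n%:R) * w1 x.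
    move=> fx; rewrite normrM (ger0_norm (expR_ge0 _)) -mulrA.
    apply: ler_pM => //; rewrite /w1 -expRD ler_expR mul1r -natr1 mulrDl mul1r.
    rewrite lerD2r mulrC -subr_ge0 (_ : _ - _ = n%:R * (fs - eta - f x)); last by ring.
    by rewrite mulr_ge0// subr_ge0 f_gap.
  have iC := integrableZl mfar (C * expR (- eta * n%:R)) iw1.
  have iphi : leb.-integrable (far d : set (measurableTypeR R))
      (EFin \o (fun x => phi x * expR (n.+1%:R * (f x - fs)))).
    apply: le_integrable iC => //.
      apply/measurable_EFinP; apply: measurable_funTS.
      apply: measurable_funM => //; apply: measurableT_comp => //.
      by apply: measurable_funM => //; exact: measurable_funB.
    by move=> x fx; rewrite /= lee_fin (le_trans (bd x fx))// ler_norm.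
  apply: (le_trans (le_normr_Rintegral mfar iphi)).
  rewrite -RintegralZl//; apply: le_Rintegral => //; exact: integrable_norm.
apply: norm_cvg0.
apply: (@squeeze_cvgr _ _ _ _ (cst 0) (fun n => n.+1%:R * expR (- eta * n%:R) * (C * K))).
- apply: nearW => n; rewrite /= normr_ge0/= normrM ger0_norm ?powR_ge0//.
  rewrite -mulrA (mulrA _ C) (mulrC _ C); apply: ler_pM; rewrite ?powR_ge0//.
  (* Since [p <= 1], the normalizing power is at most [n.+1], the factor handled by
     [cvg_mul_expRN]. *)
  rewrite -[leRHS](@powRr1 _ n.+1%:R)// ler_powR// ?ler1n//.
  by rewrite invf_le1 ?ltr0n ?double_gt0// ler1n double_gt0.
- exact: cvg_cst.
- exact: cvg_mul_expRN.
Qed.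

Definition laplace_const : R := \int[leb]_y expR (- y ^+ kstar.*2).

(** The natural scale at [mu] has exponent [q = 1 / (2 k mu) >= p]. Normalizing with [p] leaves a
    factor [n.+1 ^ (- (q - p))], which is 1 for the largest type and tends to 0 otherwise. *)
Lemma laplace_at (phi : R -> R) (C mu : R) : continuous phi ->
  (forall x, `|phi x| <= C) -> mu \in M ->
  exists2 d0 : R, 0 < d0 & forall d, 0 < d -> d <= d0 ->
  (fun n => n.+1%:R `^ p * \int[leb]_(x in ball mu d)
    (phi x * expR (n.+1%:R * (f x - fs)))) @ \oo -->
  (if k mu == kstar then laplace_const * (a mu `^ (- p) * phi mu) else 0).
Proof.
move=> cphi phiC muM.
have iw' n : leb.-integrable setT (EFin \o (fun x => expR (n.+1%:R * (f x - f mu)))).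
  by rewrite (f_max mu muM); exact: iw.
have [d0 d00 H] := laplace_local f phi mu (a mu) C (k mu) (k_gt0 mu muM)
  (a_gt0 mu muM) cf cphi phiC iw' (taylor mu muM).
exists d0 => // d dpos dd0; have {H} := H d dpos dd0.
rewrite (f_max mu muM).
pose q : R := (k mu).*2%:R^-1.
have am0 := a_gt0 mu muM.
have sE n : n.+1%:R `^ p = a mu `^ (- q) * n.+1%:R `^ (- (q - p)) *
    (a mu * n.+1%:R) `^ q.
  have nE : n.+1%:R `^ p = n.+1%:R `^ (- (q - p)) * n.+1%:R `^ q :> R.
    by rewrite -powRD ?pnatr_eq0 ?implybT//; congr powR; ring.
  rewrite powRM ?(ltW am0)// mulrACA powRN mulVf ?mul1r//.
  by rewrite gt_eqF// powR_gt0.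
move=> H.
have -> : (fun n => n.+1%:R `^ p * \int[leb]_(x in ball mu d)
      (phi x * expR (n.+1%:R * (f x - fs)))) =
    (fun n => a mu `^ (- q) * n.+1%:R `^ (- (q - p)) * ((a mu * n.+1%:R) `^ q *
      \int[leb]_(x in ball mu d) (phi x * expR (n.+1%:R * (f x - fs))))).
  by apply/funext => n; rewrite sE -!mulrA.
case: eqP => [kk|/eqP kk].
  have qp : q = p by rewrite /q /p kk.
  rewrite (_ : laplace_const * _ = a mu `^ (- q) * 1 * (phi mu * laplace_const)); last first.
    by rewrite qp; ring.
  apply: cvgM; last by rewrite /laplace_const -kk.
  apply: cvgM; first exact: cvg_cst.
  rewrite qp subrr oppr0; under eq_fun do rewrite powRr0; exact: cvg_cst.
rewrite -(mul0r (phi mu * \int[leb]_y expR (- y ^+ (k mu).*2))).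
apply: cvgM => //.
rewrite -(mulr0 (a mu `^ (- q))); apply: cvgM; first exact: cvg_cst.
apply: cvg_powR_neg; rewrite subr_gt0 ltf_pV2 ?posrE ?ltr0n ?double_gt0// ?k_gt0//.
by rewrite ltr_nat ltn_double ltn_neqAle kk k_le.
Qed.

Lemma laplace_limit (phi : R -> R) (C : R) : continuous phi ->
  (forall x, `|phi x| <= C) ->
  (fun n => n.+1%:R `^ p * \int[leb]_x (phi x * expR (n.+1%:R * (f x - fs)))) @ \oo -->
  laplace_const * \sum_(mu <- M | k mu == kstar) a mu `^ (- p) * phi mu.
Proof.
move=> cphi phiC.
pose L mu := if k mu == kstar then laplace_const * (a mu `^ (- p) * phi mu) else 0.
have [d1 d10 H1] := @seq_radius R M (fun mu d => forall d', 0 < d' -> d' <= d ->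
  (fun n => n.+1%:R `^ p * \int[leb]_(x in ball mu d')
    (phi x * expR (n.+1%:R * (f x - fs)))) @ \oo --> L mu)
  (fun x d d' H _ dd e e0 ed => H e e0 (le_trans ed dd))
  (fun mu muM => laplace_at phi C mu cphi phiC muM).
(* A radius making the balls around distinct maxima disjoint, obtained as a minimum over [x] and
   then over [y]; the witness 1 is arbitrary, for the vacuous case [x = y]. *)
have [d2 d20 H2] := @seq_radius R M
  (fun x d => forall y, y \in M -> x != y -> 2 * d <= `|x - y|)
  (fun x d d' H _ dd y yM xy => le_trans (ler_wpM2l (ler0n _ 2) dd) (H y yM xy))
  (fun x xM => @seq_radius R M (fun y d => x != y -> 2 * d <= `|x - y|)
    (fun y d d' H _ dd xy => le_trans (ler_wpM2l (ler0n _ 2) dd) (H xy))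
    ltac:(move=> y yM; have [->|xy] := eqVneq x y;
      [by exists 1|exists (`|x - y| / 2); [by rewrite divr_gt0// normr_gt0 subr_eq0|
        by move=> _; rewrite mulrC divfK]])).
pose d := Num.min d1 d2.
have d0 : 0 < d by rewrite lt_min d10.
have dd1 : d <= d1 by rewrite ge_min lexx.
have dd2 : d <= d2 by rewrite ge_min lexx orbT.
have mphi := continuous_measurable_fun cphi.
have mf := continuous_measurable_fun cf.
have iG n : leb.-integrable setT
    (EFin \o (fun x => phi x * expR (n.+1%:R * (f x - fs)))).
  have iC := integrableZl measurableT C (iw n).
  apply: le_integrable iC => //.
    apply/measurable_EFinP; apply: measurable_funM => //; apply: measurableT_comp => //.
    by apply: measurable_funM => //; exact: measurable_funB.
  move=> x _; rewrite /= lee_fin normrM [in leRHS]normrM ler_wpM2r//.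
  by rewrite (le_trans (phiC x))// ler_norm.
have split_int n : n.+1%:R `^ p * \int[leb]_x (phi x * expR (n.+1%:R * (f x - fs))) =
    \sum_(mu <- M) (n.+1%:R `^ p * \int[leb]_(x in ball mu d)
      (phi x * expR (n.+1%:R * (f x - fs)))) +
    n.+1%:R `^ p * \int[leb]_(x in far d) (phi x * expR (n.+1%:R * (f x - fs))).
  rewrite -big_distrr/= -Rintegral_near_seq//; last first.
    move=> x y xM yM xy; apply: le_trans (H2 _ xM _ yM xy).
    by rewrite ler_pM2l.
  rewrite -mulrDr far_setC -Rintegral_setU ?setUv//.
  - by apply: measurableC; exact: measurable_near_seq.
  - by rewrite disj_set2E setICr.
have sum_cvg s : {subset s <= M} ->
    (fun n => \sum_(mu <- s) (n.+1%:R `^ p * \int[leb]_(x in ball mu d)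
      (phi x * expR (n.+1%:R * (f x - fs))))) @ \oo --> \sum_(mu <- s) L mu.
  elim: s => [|mu s IH] sM.
    by under eq_fun do rewrite big_nil; rewrite big_nil; exact: cvg_cst.
  under eq_fun do rewrite big_cons; rewrite big_cons; apply: cvgD.
    by apply: H1 => //; apply: sM; exact: mem_head.
  by apply: IH => nu nus; apply: sM; rewrite inE nus orbT.
have -> : laplace_const * \sum_(mu <- M | k mu == kstar) a mu `^ (- p) * phi mu =
    \sum_(mu <- M) L mu + 0.
  by rewrite addr0 big_distrr/= big_mkcond.
under eq_fun do rewrite split_int.
by apply: cvgD; [exact: sum_cvg|exact: (laplace_far phi C)].
Qed.

Lemma laplace_const_gt0 : 0 < laplace_const.
Proof.
apply: Rintegral_gt0; first exact: lebesgue_measure_setT_neq0.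
  by move=> x; exact: expR_gt0.
exact: integrable_expRN_even.
Qed.

End LaplaceMethod.

(** * The Curie-Weiss model *)

Section Assembly.
Context {R : realType}.
Notation leb := (@lebesgue_measure R).
Variables (rho : probability R R) (J h : R).
Hypothesis J_gt0 : 0 < J.
Hypothesis mgf : forall a b : R, 0 < a ->
  (\int[rho]_x (expR (a * x ^+ 2 / 2 + b * x))%:E < +oo)%E.

Local Notation f := (fCW rho J h).

(** From [J * (x / 2 - s)^2 >= 0], [s * J * x <= J / 4 * x^2 + J * s^2]. This costs half of the term
    [- J / 2 * x^2] and leaves a constant, finite by [mgf] with [a = 2 * J]. *)
Lemma fCW_le : exists B : R, forall x, f x <= - (J / 4) * x ^+ 2 + B.
Proof.
pose G s := expR (2 * J * s ^+ 2 / 2 + h * s).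
have mG : measurable_fun setT G.
  apply: measurableT_comp => //; apply: measurable_funD; last exact: measurable_funM.
  by do 2 (apply: measurable_funM => //); exact: measurable_funX.
have iG : rho.-integrable setT (EFin \o G).
  apply/integrableP; split; first by apply/measurable_EFinP.
  under eq_integral do rewrite gee0_abs ?lee_fin ?expR_ge0//.
  by apply: mgf; rewrite mulr_gt0.
have iL x := tilted_moment_integrable rho (exp_int_of_mgf rho mgf) 0 (J * x + h).
have L0 x := tilted_moment0_gt0 rho (exp_int_of_mgf rho mgf) (J * x + h).
have L_le x : tilted_moment rho 0 (J * x + h) <= expR (J / 4 * x ^+ 2) * \int[rho]_s G s.
  have iE := integrableZl measurableT (expR (J / 4 * x ^+ 2)) iG.
  rewrite -RintegralZl//; apply: le_Rintegral => //.
  move=> s _; rewrite expr0 mul1r /G -expRD ler_expR -subr_ge0.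
  rewrite (_ : _ - _ = J * (x / 2 - s) ^+ 2); last by field.
  by rewrite mulr_ge0 ?sqr_ge0// ltW.
exists (ln (\int[rho]_s G s)) => x.
have G0 : 0 < \int[rho]_s G s.
  by have := lt_le_trans (L0 x) (L_le x); rewrite pmulr_rgt0 ?expR_gt0.
rewrite fCW_tilted_moment.
have : ln (tilted_moment rho 0 (J * x + h)) <= J / 4 * x ^+ 2 + ln (\int[rho]_s G s).
  rewrite -[J / 4 * _]expRK -lnM ?posrE ?expR_gt0// ler_ln ?posrE//.
  by rewrite mulr_gt0// expR_gt0.
by move=> H; lra.
Qed.

Lemma derive1nB_cst (F : R -> R) (c : R) j : Cn 1 F ->
  derive1n j.+1 (fun x => F x - c) = derive1n j.+1 F.
Proof.
move=> CF; rewrite /derive1n !iterSr; congr iter; apply/funext => x.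
rewrite !derive1E; have dF := Cn_is_derive 0 F x CF.
have d : is_derive x (1:R) (fun x => F x - c) (F^`()%classic x).
  rewrite -[X in is_derive _ _ _ X]subr0.
  exact: (@is_deriveB _ _ _ F (cst c) x 1).
by rewrite (@derive_val _ _ _ _ _ _ _ d) (@derive_val _ _ _ _ _ _ _ dF).
Qed.

(** [taylor_peano] also asks for a zero derivative of order 0, hence its use on [f - f mu]. *)
Lemma fCW_taylor (mu lam : R) (k : nat) : (0 < k)%N ->
  (forall j, (1 <= j <= k.*2.-1)%N -> derive1n j f mu = 0) ->
  derive1n k.*2 f mu = lam ->
  forall e : R, 0 < e -> exists2 d : R, 0 < d & forall t : R, `|t| < d ->
  `|f (mu + t) - f mu + - lam / (k.*2)`!%:R * t ^+ k.*2| <= e * t ^+ k.*2.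
Proof.
move=> k0 fj fk e e0.
have Cf n : Cn n f := Cn_fCW rho J h mgf n.
have Cg n : Cn n (fun x => f x - f mu) by apply: CnD => //; exact: Cn_cst.
have [||d d0 H] := taylor_peano k.*2 (fun x => f x - f mu) mu lam (Cg _) _ _ e e0.
- case=> [_|j jk]; first by rewrite derive1n0 subrr.
  by rewrite derive1nB_cst// fj//= -ltnS prednK ?double_gt0.
- by rewrite -fk -(prednK (n := k.*2)) ?double_gt0// derive1nB_cst.
exists d => // t td; rewrite -[in leRHS]expr_double_norm.
by have := H t td; congr (`|_| <= _); field; rewrite pnatr_eq0 -lt0n fact_gt0.
Qed.

Lemma bigmax_attained (k : R -> nat) (s : seq R) : (exists x, x \in s) ->
  exists2 x, x \in s & k x = (\max_(y <- s) k y)%N.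
Proof.
elim: s => [[]//|y s IH _]; rewrite big_cons.
have [ks|ks] := leqP (\max_(j <- s) k j) (k y).
  by exists y; rewrite ?mem_head// (maxn_idPl ks).
have [|x xs kx] := IH.
  by case: s ks {IH} => [|z s _]; [rewrite big_nil|exists z; rewrite mem_head].
by exists x; rewrite ?inE ?xs ?orbT// kx (maxn_idPr (ltnW ks)).
Qed.

Lemma integrable_expR_fCW n (c : R) :
  leb.-integrable setT (EFin \o (fun x => expR (n.+1%:R * (f x - c)))).
Proof.
(* Trivial data: only the integrability of the weight is wanted. *)
have [|||||||iw _ _] := @gibbs_smoothing R rho J h J_gt0 mgf n.+1 isT (cst 0) (cst 0) 0 0 1.
- exact: ltr01.
- exact: lexx.
- by [].
- by move=> x; rewrite normr0.
- by [].
- by move=> x; rewrite lexx ler01.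
- by move=> m x _; rewrite subrr normr0 !mulr0 addr0.
have := integrableZl measurableT (expR (- (n.+1%:R * c))) iw.
congr (integrable _ _ _); apply/funext => x /=.
by rewrite -EFinM -expRD; congr (expR _)%:E; ring.
Qed.

(** * Gibbs expectations against quotients of Laplace integrals *)

Section Compare.
Variables (M : seq R) (fs C : R) (g : R -> R).
Hypotheses (g_cont : continuous g) (gC : forall x, `|g x| <= C).

Let v n x := expR (n.+1%:R * (f x - fs)).

(** [gibbs_smoothing] with [o] the indicator of [far M d]. If [x] is [d]-close to some [mu] and [m]
    is [d]-close to [x], then both are within [2 * d] of [mu], so control of [g] near [M] is
    enough. *)
Lemma gibbs_expect_laplace n (d e : R) : 0 < d -> 0 <= e ->
  (forall mu x, mu \in M -> `|x - mu| < 2 * d -> `|g x - g mu| <= e / 2) ->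
  0 < \int[leb]_x (1 * v n x) /\
  `|gibbs_expect rho J h g n.+1 - (\int[leb]_x (g x * v n x)) / (\int[leb]_x (1 * v n x))|
   <= e + 2 * C * ((\int[leb]_(x in far M d) (1 * v n x)) / (\int[leb]_x (1 * v n x)))
     + 2 * C * Num.sqrt 2 * expR (- (n.+1%:R * J / 4 * d ^+ 2)).
Proof.
move=> d0 e0 gM.
have C0 : 0 <= C by apply: le_trans (gC 0).
have iv := integrable_expR_fCW n fs.
have mfar := measurable_far M d.
pose o : R -> R := \1_(far M d).
have mo : measurable_fun setT o by exact: measurable_indic.
have mg := continuous_measurable_fun g_cont.
have o01 x : 0 <= o x <= 1 by rewrite /o indicE; case: (_ \in _); rewrite /= ?lexx ?ler01.
have go m x : `|x - m| < d -> `|g m - g x| <= e + 2 * C * o x.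
  move=> xm; rewrite /o indicE.
  have [xfar|] := boolP (x \in far M d).
    rewrite mulr1 (le_trans (ler_normB _ _))// (le_trans (lerD (gC m) (gC x)))//.
    by rewrite mulr_natl mulr2n lerDr.
  rewrite mulr0 addr0 notin_setE far_setC => /contrapT[mu muM].
  rewrite -ball_normE/= => mux.
  have mum : `|m - mu| < 2 * d.
    rewrite (_ : m - mu = - (mu - x) - (x - m)); last by ring.
    by rewrite (le_lt_trans (ler_normB _ _))// normrN mulr_natl mulr2n ltrD.
  have mux2 : `|x - mu| < 2 * d.
    by rewrite distrC (lt_le_trans mux)// ler_peMl ?(ltW d0)// ler1n.
  rewrite (_ : g m - g x = (g m - g mu) - (g x - g mu)); last by ring.
  rewrite (le_trans (ler_normB _ _))// [leRHS]splitr lerD//; exact: gM.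
have [iw W_gt0] := @gibbs_smoothing R rho J h J_gt0 mgf n.+1 isT g o C e d
  d0 e0 mg gC mo o01 go.
set w := fun x => expR (n.+1%:R * f x) in iw W_gt0 *.
(* Subtracting the maximum [fs] in the exponent rescales all the integrals by [K], which cancels in
   the quotients. *)
pose K := expR (n.+1%:R * fs).
have K0 : 0 < K by exact: expR_gt0.
have wE x : w x = K * v n x by rewrite /w /K /v -expRD; congr expR; ring.
have scale (phi : R -> R) (B : R) : measurable_fun setT phi -> (forall x, `|phi x| <= B) ->
    \int[leb]_x (phi x * w x) = K * \int[leb]_x (phi x * v n x).
  move=> mphi phiB; rewrite -RintegralZl//.
    by apply: eq_Rintegral => x _; rewrite wE mulrCA.
  have iB := integrableZl measurableT B iv.
  apply: le_integrable iB => //.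
    apply/measurable_EFinP; apply: measurable_funM => //.
    by case/integrableP : iv => /measurable_EFinP.
  move=> x _; rewrite /= lee_fin normrM [in leRHS]normrM ler_wpM2r//.
  by rewrite (le_trans (phiB x))// ler_norm.
have WE : \int[leb]_x w x = K * \int[leb]_x (1 * v n x).
  rewrite -(scale (cst 1) 1)//; last by move=> x; rewrite normr1.
  by apply: eq_Rintegral => x _; rewrite mul1r.
have farE : \int[leb]_(x in far M d) (1 * v n x) = \int[leb]_x (o x * v n x).
  rewrite Rintegral_mkcond; apply: eq_Rintegral => x _.
  by rewrite patchE /o indicE; case: ifP; rewrite ?mul1r ?mul0r.
have ratio (x y : R) : (K * x) / (K * y) = x / y.
  by rewrite -mulf_div divff ?mul1r// gt_eqF.
move=> H; split; first by move: W_gt0; rewrite WE pmulr_rgt0.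
move: H; rewrite WE (scale g C)// (scale o 1)//; last first.
  by move=> x; rewrite ger0_norm; have /andP[] := o01 x.
by rewrite !ratio farE.
Qed.

End Compare.

End Assembly.

Theorem theorem1 (R : realType) (rho : probability R R) (J h : R)
  (nondeg : forall a : R, (rho [set a] < 1)%E)
  (mgf : forall a b : R, 0 < a ->
     (\int[rho]_x (expR (a * x ^+ 2 / 2 + b * x))%:E < +oo)%E)
  (J_gt0 : 0 < J)
  (M : seq R) (M_uniq : uniq M)
  (M_max : forall x : R,
     x \in M <-> (forall y : R, fCW rho J h y <= fCW rho J h x))
  (k : R -> nat) (lam : R -> R)
  (k_lam : forall mu : R, mu \in M ->
     [/\ (0 < k mu)%N,
         (forall j : nat, (1 <= j <= (k mu).*2.-1)%N ->
            derive1n j (fCW rho J h) mu = 0),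
         derive1n (k mu).*2 (fCW rho J h) mu = lam mu
       & lam mu < 0])
  (g : R -> R) (g_cont : continuous g)
  (g_bnd : exists C : R, forall x : R, `|g x| <= C) :
  let kstar := (\max_(mu <- M) k mu)%N in
  let b := fun mu : R => powR (- lam mu) (- ((kstar.*2)%:R)^-1) in
  gibbs_expect rho J h g n @[n --> \oo] -->
    (\sum_(mu <- M | k mu == kstar) b mu * g mu) /
    (\sum_(mu <- M | k mu == kstar) b mu).
Proof.
move=> kstar b; have [C gC] := g_bnd.
have C0 : 0 <= C by apply: le_trans (gC 0).
pose f := fCW rho J h.
have cf : continuous f := continuous_fCW rho J h mgf.
have [B f_le] := fCW_le rho J h J_gt0 mgf.
have J4_gt0 : 0 < J / 4 by rewrite divr_gt0.
(* Rules out an empty [M], for which [kstar] would be the default value 0 of the maximum. *)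
have [mu0 mu0M] := maximizer_exists f _ B J4_gt0 cf f_le M M_max.
pose fs := f mu0.
have f_max mu : mu \in M -> f mu = fs.
  move=> muM; apply/eqP; rewrite eq_le; apply/andP; split.
    by move/M_max : mu0M; apply.
  by move/M_max : muM; apply.
have [mus musM kmus] := bigmax_attained k M (ex_intro _ mu0 mu0M).
have k_gt0 mu : mu \in M -> (0 < k mu)%N by case/k_lam.
have kstar_gt0 : (0 < kstar)%N by rewrite /kstar -kmus; exact: k_gt0.
have k_le mu : mu \in M -> (k mu <= kstar)%N by move=> muM; exact: leq_bigmax_seq.
pose a mu := - lam mu / ((k mu).*2)`!%:R.
have lam_gt0 mu : mu \in M -> 0 < - lam mu by case/k_lam => _ _ _; rewrite oppr_gt0.
have a_gt0 mu : mu \in M -> 0 < a mu.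
  by move=> muM; rewrite divr_gt0 ?lam_gt0// ltr0n fact_gt0.
have taylor mu : mu \in M -> forall e : R, 0 < e -> exists2 d : R, 0 < d &
    forall t : R, `|t| < d ->
    `|f (mu + t) - f mu + a mu * t ^+ (k mu).*2| <= e * t ^+ (k mu).*2.
  by move=> muM; have [kmu fj fk _] := k_lam mu muM; exact: fCW_taylor.
have gap (d : R) : 0 < d -> exists2 eta : R, 0 < eta &
    forall x, (forall mu, mu \in M -> d <= `|x - mu|) -> f x <= fs - eta.
  exact: max_gap f _ B J4_gt0 cf f_le M M_max mu0 d mu0M.
have iw n : (@lebesgue_measure R).-integrable setT (EFin \o (fun x => expR (n.+1%:R * (f x - fs)))).
  exact: integrable_expR_fCW.
pose p : R := (kstar.*2)%:R^-1.
pose v n x := expR (n.+1%:R * (f x - fs)).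
pose A (phi : R -> R) n := n.+1%:R `^ p * \int[lebesgue_measure]_x (phi x * v n x).
pose S (phi : R -> R) := \sum_(mu <- M | k mu == kstar) a mu `^ (- p) * phi mu.
have A_cvg (phi : R -> R) (c : R) : continuous phi -> (forall x, `|phi x| <= c) ->
    A phi @ \oo --> laplace_const kstar * S phi.
  exact: laplace_limit.
have one_cont : continuous (cst (1 : R) : R -> R) by move=> x; exact: cvg_cst.
have one_le (x : R) : `|cst (1 : R) x| <= 1 :> R by rewrite normr1.
have S1_gt0 : 0 < S (cst 1).
  rewrite /S (big_rem mus)//= kmus eqxx ltr_pwDl//.
    by rewrite mulr1 powR_gt0// a_gt0.
  by apply: sumr_ge0 => mu _; rewrite mulr_ge0// powR_ge0.
have c_gt0 : 0 < laplace_const kstar :> R := laplace_const_gt0 kstar kstar_gt0.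
(* Only maxima of type [kstar] enter the sum, so the factorials in [a] are all equal and factor
   out. *)
have SE phi : S phi = (kstar.*2)`!%:R^-1 `^ (- p) *
    \sum_(mu <- M | k mu == kstar) b mu * phi mu.
  rewrite /S big_distrr/= big_seq_cond [RHS]big_seq_cond; apply: eq_bigr => mu.
  move=> /andP[muM /eqP kmu]; rewrite /a kmu powRM ?invr_ge0 ?(ltW (lam_gt0 _ muM))//.
  by rewrite mulrCA mulrA.
have limE : (\sum_(mu <- M | k mu == kstar) b mu * g mu) /
    (\sum_(mu <- M | k mu == kstar) b mu) =
    (laplace_const kstar * S g) / (laplace_const kstar * S (cst 1)).
  rewrite !SE !mulrA -mulf_div divff ?mul1r; last first.
    rewrite mulf_neq0// gt_eqF// powR_gt0// invr_gt0 ltr0n fact_gt0//.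
  by congr (_ / _); apply: eq_bigr => mu _; rewrite mulr1.
(* Shifting to [n.+1] spins discards the degenerate case of no spin. *)
rewrite limE -cvg_shiftS/=.
have r_cvg : (fun n => A g n / A (cst 1) n) @ \oo -->
    (laplace_const kstar * S g) / (laplace_const kstar * S (cst 1)).
  apply: cvgM; first exact: A_cvg gC.
  by apply: cvgV; [rewrite gt_eqF// mulr_gt0|exact: A_cvg one_le].
have AE phi n : (\int[lebesgue_measure]_x (phi x * v n x)) / (\int[lebesgue_measure]_x (1 * v n x)) =
    A phi n / A (cst 1) n.
  by rewrite /A -mulf_div divff ?mul1r// gt_eqF// powR_gt0.
suff diff_cvg : (fun n => gibbs_expect rho J h g n.+1 - A g n / A (cst 1) n) @ \oo --> (0 : R).
  have -> : (fun n => gibbs_expect rho J h g n.+1) =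
      (fun n => (gibbs_expect rho J h g n.+1 - A g n / A (cst 1) n) + A g n / A (cst 1) n).
    by apply/funext => n; rewrite subrK.
  have := cvgD diff_cvg r_cvg; rewrite add0r; exact.
apply/cvgrPdist_lt => e e0.
have e20 : 0 < e / 2 by rewrite divr_gt0.
(* Continuity at finitely many points gives a common radius, halved because [gibbs_expect_laplace]
   looks up to distance [2 * d]. *)
have [d d0 Hd] : exists2 d : R, 0 < d & forall mu, mu \in M -> forall x,
    `|x - mu| < 2 * d -> `|g x - g mu| <= e / 2 / 2.
  apply: seq_radius => [mu d d' H d'0 dd x xmu|mu _].
    by apply: H; rewrite (lt_le_trans xmu)// ler_pM2l.
  have /cvgrPdist_le /(_ _ (divr_gt0 e20 (ltr0n _ 2))) := g_cont mu.
  rewrite near_simpl => -[d /= d0 H]; exists (d / 2); first by rewrite divr_gt0.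
  move=> x; rewrite mulrC divfK// => xmu; rewrite distrC; apply: H => /=.
  by rewrite distrC.
pose D n := n.+1%:R `^ p * \int[lebesgue_measure]_(x in far M d) (1 * v n x).
have D_cvg : D @ \oo --> (0 : R).
  exact: (laplace_far f fs M kstar cf gap iw kstar_gt0 (cst 1) 1 d one_cont one_le d0).
have eta_cvg : (fun n => expR (- (n.+1%:R * J / 4 * d ^+ 2))) @ \oo --> (0 : R).
  pose eta := J / 4 * d ^+ 2.
  have eta0 : 0 < eta by rewrite mulr_gt0// exprn_gt0.
  apply: (@squeeze_cvgr _ _ _ _ (cst 0) (fun n => n.+1%:R * expR (- eta * n%:R) * 1)).
  - apply: nearW => n; rewrite /= expR_ge0/= mulr1.
    apply: (@le_trans _ _ (expR (- eta * n%:R))).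
      rewrite ler_expR /eta -natr1; nra.
    by rewrite ler_peMl ?expR_ge0// ler1n.
  - exact: cvg_cst.
  - exact: cvg_mul_expRN.
(* With [d] fixed, the last two terms vanish in the limit; the bound tends to [e / 2] and is thus
   eventually below [e]. *)
have bound_cvg : (fun n => e / 2 + 2 * C * (D n / A (cst 1) n) +
    2 * C * Num.sqrt 2 * expR (- (n.+1%:R * J / 4 * d ^+ 2))) @ \oo --> e / 2.
  rewrite -[X in _ --> X]addr0 -[X in X + _]addr0; apply: cvgD.
    apply: cvgD; first exact: cvg_cst.
    rewrite -[X in _ --> X](mulr0 (2 * C)); apply: cvgM; first exact: cvg_cst.
    rewrite -(mul0r (laplace_const kstar * S (cst 1))^-1); apply: cvgM => //.
    by apply: cvgV; [rewrite gt_eqF// mulr_gt0|exact: A_cvg one_le].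
  rewrite -[X in _ --> X](mulr0 (2 * C * Num.sqrt 2)); apply: cvgM => //.
  exact: cvg_cst.
have e2e : e / 2 < e by rewrite ltr_pdivrMr// ltr_pMr// ltr1n.
have /cvgr_lt /(_ _ e2e) := bound_cvg; apply: filterS => n Hn.
rewrite sub0r normrN; apply: le_lt_trans Hn.
have [_ H] := gibbs_expect_laplace rho J h J_gt0 mgf M fs C g g_cont gC n d (e / 2)
  d0 (ltW e20) (fun mu x muM => Hd mu muM x).
have DE : (\int[lebesgue_measure]_(x in far M d) (1 * v n x)) /
    (\int[lebesgue_measure]_x (1 * v n x)) = D n / A (cst 1) n.
  by rewrite /D /A -mulf_div divff ?mul1r// gt_eqF// powR_gt0.
by rewrite -AE -DE.
Qed.
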